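(* Suppose that $f_i'(u)+1\ne0$ and $f_i''(u)\ne0$ for all $u\in\mathbb R$ and all $1\le i\le k$. Then $\mathcal M_F$ is not $2$-curvature homogeneous.
   Context: Fix an integer $k\ge 1$ and signs $\varepsilon_1,\dots,\varepsilon_k\in\{\pm1\}$. Let $f_1,\dots,f_k:\mathbb R\to\mathbb R$ be smooth, $F=(f_1,\dots,f_k)$. On $\mathbb R^{3k+2}$ with coordinates $(u_0,\dots,u_k,v_0,\dots,v_k,s_1,\dots,s_k)$ let $g_F$ be the symmetric metric whose only nonzero components on coordinate vector fields are (up to symmetry), for $1\le i\le k$ and $0\le i',j\le k$: $g_F(\partial_{u_0},\partial_{u_i})=2f_i(u_i)s_i$, $g_F(\partial_{u_i},\partial_{u_i})=-2u_0s_i$, $g_F(\partial_{u_{i'}},\partial_{v_j})=\delta_{i'j}$, $g_F(\partial_{s_i},\partial_{s_i})=\varepsilon_i$; $\mathcal M_F=(\mathbb R^{3k+2},g_F)$. $\nabla$ is the Levi-Civita connection, $R(X,Y,Z,W)=g_F(\nabla_X\nabla_YZ-\nabla_Y\nabla_XZ-\nabla_{[X,Y]}Z,W)$, and $\nabla^\ell R(X_1,\dots,X_4;Y_1,\dots,Y_\ell)=(\nabla_{Y_\ell}\nabla^{\ell-1}R)(X_1,\dots,X_4;Y_1,\dots,Y_{\ell-1})$. A pseudo-Riemannian manifold $(M,g)$ is $\ell$-curvature homogeneous if for all $P,Q\in M$ there is a linear isometry $\Phi:T_PM\to T_QM$ with $\Phi^*(\nabla^iR)_Q=(\nabla^iR)_P$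 for $i=0,\dots,\ell$. *)

(* Defs.v *)
From HB Require Import structures.
From mathcomp Require Import all_boot all_order all_algebra.
From mathcomp Require Import all_classical all_reals all_analysis.
Set Implicit Arguments. Unset Strict Implicit. Unset Printing Implicit Defensive.
Import Order.TTheory GRing.Theory Num.Theory.
Import numFieldNormedType.Exports.
Local Open Scope ring_scope.

Section Geometry.
Variable R : realType.

Definition smooth (f : R -> R) : Prop :=
  forall (m : nat) (x : R), derivable (derive1n m f) x 1.

Variable n : nat.
Notation pt := 'rV[R]_n.

Definition pd (i : 'I_n) (h : pt -> R) (x : pt) : R :=
  'D_(delta_mx 0 i) h x.

(** A metric is given by its matrix of components g_{ab}(x) = g(d_a, d_b). *)
Variable g : pt -> 'M[R]_n.

Definition ginv (x : pt) : 'M[R]_n := invmx (g x).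

(** Christoffel symbols of the Levi-Civita connection:
    nabla_{d_i} d_j = \sum_m Gam i j m * d_m *)
Definition Gam (i j m : 'I_n) (x : pt) : R :=
  2^-1 * \sum_(l < n) ginv x m l *
    (pd i (fun y => g y j l) x + pd j (fun y => g y i l) x
     - pd l (fun y => g y i j) x).

(** (1,3) curvature components: R(d_i,d_j)d_k = \sum_p Rup i j k p * d_p,
    with R(X,Y)Z = nabla_X nabla_Y Z - nabla_Y nabla_X Z - nabla_[X,Y] Z *)
Definition Rup (i j k p : 'I_n) (x : pt) : R :=
  pd i (Gam j k p) x - pd j (Gam i k p) x
  + \sum_(m < n) (Gam j k m x * Gam i m p x - Gam i k m x * Gam j m p x).

Definition Rlow (i j k l : 'I_n) (x : pt) : R :=
  \sum_(p < n) Rup i j k p x * g x p l.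

(** covariant r-tensor fields, given by their components *)
Definition tensor (r : nat) := {ffun 'I_r -> 'I_n} -> pt -> R.

Definition Rtensor : tensor 4 :=
  fun a x => Rlow (a 0) (a 1) (a 2%:R) (a 3%:R) x.

(** covariant derivative; the new (derivation) slot is the last one:
    (nabla T)(X_1..X_r; Y) = (nabla_Y T)(X_1..X_r) *)
Definition cov_deriv (r : nat) (T : tensor r) : tensor r.+1 :=
  fun a x =>
    let c := a ord_max in
    let a' : {ffun 'I_r -> 'I_n} := [ffun q => a (widen_ord (leqnSn r) q)] in
    pd c (T a') x
    - \sum_(p < r) \sum_(m < n)
        Gam c (a' p) m x * T [ffun q => if q == p then m else a' q] x.

Fixpoint nablaR (l : nat) : tensor l.+4 :=
  match l with
  | 0 => Rtensor
  | l'.+1 => cov_deriv (@nablaR l')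
  end.

(** pullback of a covariant r-tensor (at a point) by the linear map with
    matrix A (Phi(d_a) = \sum_b A b a d_b) *)
Definition pullback (r : nat) (A : 'M[R]_n) (T : {ffun 'I_r -> 'I_n} -> R)
  : {ffun 'I_r -> 'I_n} -> R :=
  fun a => \sum_(b : {ffun 'I_r -> 'I_n}) (\prod_(p < r) A (b p) (a p)) * T b.

Definition curv_homogeneous (l : nat) : Prop :=
  forall P Q : pt, exists A : 'M[R]_n,
    A^T *m g Q *m A = g P /\
    forall i : nat, (i <= l)%N ->
      forall a : {ffun 'I_i.+4 -> 'I_n},
        pullback A (fun b => @nablaR i b Q) a = @nablaR i a P.

End Geometry.

(* coordinate numbering (0-based, nat positions):
   u_i  (0 <= i <= k)  at position i,
   v_j  (0 <= j <= k)  at position k+1+j,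
   s_i  (1 <= i <= k)  at position 2k+1+i.
   f i and eps i are only used for 1 <= i <= k. *)
Section Example.
Variable R : realType.
Variable k : nat.
Variable f : nat -> R -> R.
Variable eps : nat -> R.

Definition coord (x : 'rV[R]_((3 * k).+2)) (j : nat) : R := x ord0 (inord j).

Definition gF_entry (x : 'rV[R]_((3 * k).+2)) (a b : nat) : R :=
  if (a == 0)%N && (1 <= b <= k)%N then
    2 * f b (coord x b) * coord x (2 * k + 1 + b)
  else if (b == 0)%N && (1 <= a <= k)%N then
    2 * f a (coord x a) * coord x (2 * k + 1 + a)
  else if (a == b)%N && (1 <= a <= k)%N then
    - 2 * coord x 0 * coord x (2 * k + 1 + a)
  else if ((a <= k)%N && (b == a + k + 1)%N) || ((b <= k)%N && (a == b + k + 1)%N) then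
    1
  else if (a == b)%N && (2 * k + 2 <= a <= 3 * k + 1)%N then
    eps (a - (2 * k + 1))
  else 0.

Definition gF (x : 'rV[R]_((3 * k).+2)) : 'M[R]_((3 * k).+2) :=
  \matrix_(a, b) gF_entry x a b.

End Example.

(* Main.v *)
(** Writing [a_i = du_i], [b = du_0], [s_i = ds_i], the tensors [nabla^l R] are sums over [i]
    of [p_i(u_i) D_i + q_i(u_i) E_i] times [a_i^l], where
    [D_i = (a_i /\ b) (a_i /\ s_i) + (a_i /\ s_i) (a_i /\ b)] and [E_i = (a_i /\ b)^2]; moreover
    [nabla] acts by [(p, q) |-> (p', q' + 2 eps f p)].  An isometry between tangent spaces
    preserves the kernel of [R] (spanned by the [d_v]) and its orthogonal complement
    (spanned by the [d_v] and [d_s]), hence permutes the indices [i], rescaling [a_i] and [b].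
    With [w = f' + 1] this leaves two functions of [u_i] invariant,
    [w w'' / w'^2] and [(2 f (2 f' + 1) w - f^2 w') w' / w^4].
    If the manifold were 2-curvature homogeneous, then for [i = 1] both would be continuous
    with finitely many values, hence constant.  The first being constant makes [w / w'] affine
    without zeros, so [w' = lam w]; differentiating the constancy of the second then leads to
    a contradiction. *)
Require Import Defs.
From HB Require Import structures.
From mathcomp Require Import all_boot all_order all_algebra.
From mathcomp Require Import all_classical all_reals all_analysis.
From mathcomp Require Import zify ring lra.
Import Order.TTheory GRing.Theory Num.Theory.
Import numFieldNormedType.Exports.
Local Open Scope ring_scope.

Set Implicit Arguments.
Unset Strict Implicit.
Unset Printing Implicit Defensive.

(** * Coordinates and metric *)

Section Coordinates.
Variable k : nat.
Notation n := (3 * k).+2.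

Fact iu0_lt : (0 < n)%N. Proof. by []. Qed.
Fact iu_lt (i : 'I_k) : (i.+1 < n)%N. Proof. by have := ltn_ord i; lia. Qed.
Fact iv0_lt : (k.+1 < n)%N. Proof. by lia. Qed.
Fact iv_lt (i : 'I_k) : (k.+1 + i.+1 < n)%N.
Proof. by have := ltn_ord i; lia. Qed.
Fact is_lt (i : 'I_k) : ((2 * k).+1 + i.+1 < n)%N.
Proof. by have := ltn_ord i; lia. Qed.

(** Positions of [u_0], [u_(i+1)], [v_0], [v_(i+1)] and [s_(i+1)], for [i : 'I_k]. *)
Definition iu0 : 'I_n := Ordinal iu0_lt.
Definition iu i : 'I_n := Ordinal (iu_lt i).
Definition iv0 : 'I_n := Ordinal iv0_lt.
Definition iv i : 'I_n := Ordinal (iv_lt i).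
Definition is_ i : 'I_n := Ordinal (is_lt i).

(** Case analysis through [indexP] replaces arithmetic on positions by the five families of
    coordinates. *)
Variant index_spec : 'I_n -> Type :=
| IndexU0 : index_spec iu0
| IndexU i : index_spec (iu i)
| IndexV0 : index_spec iv0
| IndexV i : index_spec (iv i)
| IndexS i : index_spec (is_ i).

Lemma indexP a : index_spec a.
Proof.
have val_spec (b c : 'I_n) : b = c :> nat -> index_spec c -> index_spec b.
  by move=> /val_inj ->.
have a_lt := ltn_ord a.
case: (posnP a) => [a0|a_gt0]; first exact: (val_spec _ iu0 a0 IndexU0).
case: (leqP a k) => [a_le|a_gt].
  have i_lt : (a.-1 < k)%N by lia.
  by apply: (val_spec _ (iu (Ordinal i_lt)) _ (IndexU _)) => /=; lia.
case: (eqVneq (a : nat) k.+1) => [av|a_neq].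
  exact: (val_spec _ iv0 av IndexV0).
case: (leqP a (2 * k).+1) => [a_le|a_gt'].
  have i_lt : (a - k.+2 < k)%N by lia.
  by apply: (val_spec _ (iv (Ordinal i_lt)) _ (IndexV _)) => /=; lia.
have i_lt : (a - (2 * k).+2 < k)%N by lia.
by apply: (val_spec _ (is_ (Ordinal i_lt)) _ (IndexS _)) => /=; lia.
Qed.

Lemma iu_eq i j : (iu i == iu j) = (i == j).
Proof. by rewrite -!val_eqE /= eqSS. Qed.
Lemma iv_eq i j : (iv i == iv j) = (i == j).
Proof. by rewrite -!val_eqE /= eqn_add2l eqSS. Qed.
Lemma is_eq i j : (is_ i == is_ j) = (i == j).
Proof. by rewrite -!val_eqE /= eqn_add2l eqSS. Qed.

(** Bundled as one conjunction so that, through [indexE], a single rewrite evaluates every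
    coordinate covector on every basis vector. *)
Lemma index_neq :
  ((forall i, (iu i == iu0) = false) * (forall i, (iu0 == iu i) = false) *
   ((iv0 == iu0) = false) * ((iu0 == iv0) = false) *
   (forall i, (iv i == iu0) = false) * (forall i, (iu0 == iv i) = false) *
   (forall i, (is_ i == iu0) = false) * (forall i, (iu0 == is_ i) = false) *
   (forall i, (iv0 == iu i) = false) * (forall i, (iu i == iv0) = false) *
   (forall i j, (iv j == iu i) = false) * (forall i j, (iu i == iv j) = false) *
   (forall i j, (is_ j == iu i) = false) * (forall i j, (iu i == is_ j) = false) *
   (forall i, (iv i == iv0) = false) * (forall i, (iv0 == iv i) = false) *
   (forall i, (is_ i == iv0) = false) * (forall i, (iv0 == is_ i) = false) *
   (forall i j, (is_ j == iv i) = false) * (forall i j, (iv i == is_ j) = false))%type.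
Proof.
by do !split; move=> *; apply/eqP => /(congr1 val) /=;
  repeat (match goal with i : 'I_k |- _ => case: i => ? ? /= end); lia.
Qed.

Definition indexE := (index_neq, iu_eq, iv_eq, is_eq, eqxx).

End Coordinates.

(** * Directional derivatives of coordinate expressions *)

Section PointwiseDerivatives.
Variables (R : realType) (V : normedModType R).
Implicit Types (x v : V) (f g : V -> R).

(** A copy of [is_derive] that is not a type class: instance resolution would
    otherwise fill in derivatives of its own choice. *)
Definition has_deriv x v f (a : R) : Prop := is_derive x v f a.

Lemma has_deriv_eq x v f a b : has_deriv x v f a -> a = b -> has_deriv x v f b.
Proof. by move=> fa <-. Qed.

Lemma has_deriv_addf x v f g a b : has_deriv x v f a -> has_deriv x v g b ->
  has_deriv x v (fun y => f y + g y) (a + b).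
Proof. by move=> fa gb; exact: is_deriveD. Qed.

Lemma has_deriv_oppf x v f a :
  has_deriv x v f a -> has_deriv x v (fun y => - f y) (- a).
Proof. by move=> fa; exact: is_deriveN. Qed.

Lemma has_deriv_mulf x v f g a b : has_deriv x v f a -> has_deriv x v g b ->
  has_deriv x v (fun y => f y * g y) (a * g x + f x * b).
Proof.
move=> fa gb; apply: is_derive_eq; first exact: (is_deriveM fa gb).
by rewrite addrC /GRing.scale /= mulrC.
Qed.

Lemma has_deriv_sumf m x v (h : 'I_m -> V -> R) (dh : 'I_m -> R) :
  (forall i, has_deriv x v (h i) (dh i)) ->
  has_deriv x v (fun y => \sum_i h i y) (\sum_i dh i).
Proof.
move=> dhi; have -> : (fun y => \sum_i h i y) = \sum_i h i.
  by apply/funext => y; rewrite fct_sumE.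
exact: is_derive_sum.
Qed.

Lemma has_deriv_cstf x v (c : R) : has_deriv x v (fun=> c) 0.
Proof. exact: is_derive_cst. Qed.

End PointwiseDerivatives.

(** Along the axis [c] the difference quotient is that of [h] itself when [c = j], and identically
    zero otherwise. *)
Lemma is_derive_coord_comp (R : realType) m (h : R -> R) (c j : 'I_m)
    (x : 'rV[R]_m) : derivable h (x ord0 j) 1 ->
  is_derive x (delta_mx 0 c) (fun y => h (y ord0 j))
    (derive1 h (x ord0 j) * (c == j)%:R).
Proof.
move=> dh; have [->|cj] := eqVneq c j.
  rewrite mulr1 derive1E.
  have E : (fun t : R => t^-1 *: (((fun y : 'rV[R]_m => h (y ord0 j)) \o shift x)
      (t *: delta_mx 0 j) - h (x ord0 j))) =
      (fun t => t^-1 *: ((h \o shift (x ord0 j)) (t *: 1) - h (x ord0 j))).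
    by apply/funext => t /=; rewrite !mxE !eqxx.
  by split; rewrite /derivable /derive E.
rewrite mulr0.
have E : (fun t : R => t^-1 *: (((fun y : 'rV[R]_m => h (y ord0 j)) \o shift x)
    (t *: delta_mx 0 c) - h (x ord0 j))) = cst 0.
  apply/funext => t /=; rewrite !mxE eqxx [j == c]eq_sym (negPf cj) /=.
  by rewrite mulr0 add0r subrr scaler0.
split; rewrite /derivable /derive E; first exact: is_cvg_cst.
exact: lim_cst.
Qed.

Lemma is_derive_coord (R : realType) m (c j : 'I_m) (x : 'rV[R]_m) :
  is_derive x (delta_mx 0 c) (fun y => y ord0 j) (c == j)%:R.
Proof.
have := is_derive_coord_comp (h := id) c (j := j) (x := x) (@derivable_id _ _ _ _).
by rewrite derive1E derive_id mul1r.
Qed.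

(** * The metric as a quadratic expression in the coordinate covectors *)

Section Metric.
Variables (R : realType) (k : nat).
Notation n := (3 * k).+2.
Variables (f : nat -> R -> R) (eps : nat -> R).

(** The value of the coordinate covector dx_j on the basis vector d_a. *)
Definition dual (j a : 'I_n) : R := (a == j)%:R.
Notation be := (dual (iu0 k)).
Notation al i := (dual (iu i)).
Notation nu0 := (dual (iv0 k)).
Notation nu i := (dual (iv i)).
Notation si i := (dual (is_ i)).

Lemma sum_dual j (h : 'I_n -> R) : \sum_m dual j m * h m = h j.
Proof.
rewrite (bigD1 j) //= big1 /dual ?eqxx ?mul1r ?addr0 // => i /negPf ->.
by rewrite mul0r.
Qed.

Lemma sum_only (i : 'I_k) (h : 'I_k -> R) :
  (forall j, j != i -> h j = 0) -> \sum_j h j = h i.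
Proof. by move=> h0; rewrite (bigD1 i) //= big1 ?addr0. Qed.

(** A closed form without case distinctions, which can be differentiated termwise and simplified by
    [ring]. *)
Definition gform (x : 'rV[R]_n) (a b : 'I_n) : R :=
  be a * nu0 b + nu0 a * be b +
  \sum_(i < k) (2 * f i.+1 (x ord0 (iu i)) * x ord0 (is_ i) *
       (be a * al i b + al i a * be b)
    - 2 * x ord0 (iu0 k) * x ord0 (is_ i) * (al i a * al i b)
    + (al i a * nu i b + nu i a * al i b) + eps i.+1 * (si i a * si i b)).

Lemma coord_val (x : 'rV[R]_n) (a : 'I_n) j : j = a :> nat ->
  Defs.coord x j = x ord0 a.
Proof. by rewrite /Defs.coord => ->; rewrite inord_val. Qed.

Lemma gFE x a b : gF f eps x a b = gform x a b.
Proof.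
rewrite mxE /gform /gF_entry.
have solve0 (h : 'I_k -> R) : (forall j, h j = 0) -> \sum_j h j = 0.
  by move=> h0; rewrite big1.
case: (@indexP k a) => [|i||i|i]; case: (@indexP k b) => [|j||j|j];
  try (have := ltn_ord i); try (have := ltn_ord j); move=> /=; intros;
  repeat (case: ifPn => ?; try (exfalso; lia)).
all: try (rewrite solve0; [|by move=> l; rewrite /dual !indexE /=; ring]).
all: try (by rewrite /dual !indexE /=; ring).
1: rewrite (@sum_only j); last by
  move=> l /negPf lj; rewrite /dual !indexE [j == l]eq_sym lj /=; ring.
2-10: rewrite (@sum_only i); last by
  move=> l /negPf li; rewrite /dual !indexE [i == l]eq_sym li /=; ring.
1,2: rewrite ?(@coord_val x (iu j) j.+1) ?(@coord_val x (iu i) i.+1)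
  ?(@coord_val x (is_ j) (2 * k + 1 + j.+1))
  ?(@coord_val x (is_ i) (2 * k + 1 + i.+1)) /=; try lia.
1,2: rewrite /dual !indexE /=.
1,2: ring.
(* Both indices now run over 1, ..., k, and the entry depends on whether they agree. *)
all: case: (eqVneq i j) => [ij|ij]; try subst j;
  try (exfalso; move: ij; rewrite -?(inj_eq val_inj) /=; lia).
all: rewrite ?(@coord_val x (is_ i) (2 * k + 1 + i.+1)) ?(@coord_val x (iu0 k) 0) /=; try lia.
all: rewrite /dual !indexE ?[j == i]eq_sym ?(negPf ij) /=; try ring.
have -> : ((2 * k).+1 + i.+1 - (2 * k + 1) = i.+1)%N by lia.
ring.
Qed.
End Metric.

(** * Levi-Civita connection and curvature *)

Section LeviCivita.
Variables (R : realType) (k : nat).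
Notation n := (3 * k).+2.
Variables (f : nat -> R -> R) (eps : nat -> R).
Notation be := (@dual R k (iu0 k)).
Notation al i := (@dual R k (iu i)).
Notation nu0 := (@dual R k (iv0 k)).
Notation nu i := (@dual R k (iv i)).
Notation si i := (@dual R k (is_ i)).
Notation g := (gF f eps).
Implicit Types x : 'rV[R]_n.

Lemma gF_sym x a b : g x a b = g x b a.
Proof.
by rewrite !gFE /gform; congr (_ + _); [ring|apply: eq_bigr => i _; ring].
Qed.

Lemma gF_v0 x l : g x (iv0 k) l = be l.
Proof.
rewrite gFE /gform big1 => [|i _]; rewrite /dual !indexE /=; ring.
Qed.

Lemma gF_v x i l : g x (iv i) l = al i l.
Proof.
rewrite gFE /gform (@sum_only _ _ i); first by rewrite /dual !indexE /=; ring.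
by move=> j /negPf ji; rewrite /dual !indexE [i == j]eq_sym ji /=; ring.
Qed.

Lemma gF_s x i l : g x (is_ i) l = eps i.+1 * si i l.
Proof.
rewrite gFE /gform (@sum_only _ _ i); first by rewrite /dual !indexE /=; ring.
by move=> j /negPf ji; rewrite /dual !indexE [i == j]eq_sym ji /=; ring.
Qed.

Hypothesis eps_sqr : forall i : 'I_k, eps i.+1 * eps i.+1 = 1.

Lemma eps_neq0 (i : 'I_k) : eps i.+1 != 0.
Proof.
by apply/eqP => e0; move: (eps_sqr i); rewrite e0 mul0r => /esym/eqP;
  rewrite oner_eq0.
Qed.

(** A vector in the radical of the metric is paired with the d_v, which kills its u-components, then
    with the d_s, which kills its s-components, and finally with the d_u, which kills what is
    left. *)
Lemma gF_unit x : g x \in unitmx.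
Proof.
rewrite -row_free_unit -kermx_eq0; apply/rowV0P => v /sub_kermxP vg0.
have vE l : \sum_a v ord0 a * g x a l = 0.
  by move/matrixP/(_ ord0 l): vg0; rewrite !mxE.
have vu0 : v ord0 (iu0 k) = 0.
  rewrite -[LHS](sum_dual _ (v ord0)) -[RHS](vE (iv0 k)).
  by apply: eq_bigr => a _; rewrite gF_sym gF_v0 mulrC.
have vu i : v ord0 (iu i) = 0.
  rewrite -[LHS](sum_dual _ (v ord0)) -[RHS](vE (iv i)).
  by apply: eq_bigr => a _; rewrite gF_sym gF_v mulrC.
have vs i : v ord0 (is_ i) = 0.
  apply: (mulfI (eps_neq0 i)); rewrite mulr0 -[X in _ * X](sum_dual _ (v ord0)).
  rewrite mulr_sumr -[RHS](vE (is_ i)).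
  by apply: eq_bigr => a _; rewrite gF_sym gF_s; ring.
have vv0 : v ord0 (iv0 k) = 0.
  rewrite -[LHS](sum_dual _ (v ord0)) -[RHS](vE (iu0 k)); apply: eq_bigr => a _.
  by case: (@indexP k a) => [|i||i|i]; rewrite ?vu0 ?vu ?vs ?mul0r ?mulr0//
    ?gF_v0 ?gF_v /dual !indexE ?mulr1 ?mul1r ?mul0r ?mulr0.
have vv i : v ord0 (iv i) = 0.
  rewrite -[LHS](sum_dual _ (v ord0)) -[RHS](vE (iu i)); apply: eq_bigr => a _.
  by case: (@indexP k a) => [|j||j|j]; rewrite ?vu0 ?vu ?vs ?mul0r ?mulr0//
    ?gF_v0 ?gF_v /dual !indexE ?mulr0 ?mul0r // mulrC [i == j]eq_sym.
by apply/rowP => a; rewrite mxE; case: (@indexP k a).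
Qed.

(** Component [m] of a vector without u-components: the shape of every covariant derivative of a
    coordinate field, and of every curvature vector. *)
Definition vert (A B C : 'I_k -> R) (m : 'I_n) : R :=
  \sum_(i < k) (si i m * A i + nu0 m * B i + nu i m * C i).

Lemma sum_vert A B C (h : 'I_n -> R) : \sum_m vert A B C m * h m =
  \sum_(i < k) (A i * h (is_ i) + B i * h (iv0 k) + C i * h (iv i)).
Proof.
under eq_bigr => m _ do rewrite mulr_suml.
rewrite exchange_big; apply: eq_bigr => i _ /=.
rewrite -!(sum_dual _ h) !mulr_sumr -!big_split /=.
by apply: eq_bigr => m _; ring.
Qed.

Definition dgF (c a b : 'I_n) x : R := \sum_(i < k)
  ((2 * derive1 (f i.+1) (x ord0 (iu i)) * al i c * x ord0 (is_ i)
    + 2 * f i.+1 (x ord0 (iu i)) * si i c) * (be a * al i b + al i a * be b)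
   - 2 * (be c * x ord0 (is_ i) + x ord0 (iu0 k) * si i c) * (al i a * al i b)).

Hypothesis f_derivable : forall (i : 'I_k) t, derivable (f i.+1) t 1.

Lemma pd_gF c a b x : pd c (fun y => g y a b) x = dgF c a b x.
Proof.
have -> : (fun y => g y a b) = (fun y => gform f eps y a b).
  by apply/funext => y; rewrite gFE.
apply: derive_val; rewrite /gform.
have dc j := is_derive_coord c j x.
have df i := is_derive_coord_comp c (@f_derivable i (x ord0 (iu i))).
apply: has_deriv_eq.
  apply: has_deriv_addf; first exact: has_deriv_cstf.
  apply: has_deriv_sumf => i.
  repeat first [exact: df | exact: dc | exact: has_deriv_cstf
    | apply: has_deriv_addf | apply: has_deriv_oppf | apply: has_deriv_mulf].
by rewrite add0r; apply: eq_bigr => i _; rewrite /dual; ring.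
Qed.

(** [nabla_a d_b] has component [chrS i] along [d_(s_(i+1))], [chrV i] along
    [d_(v_(i+1))] and [\sum_i chrV0 i] along [d_(v_0)], and none along the [u]'s. *)
Definition chrS a b x (i : 'I_k) : R := eps i.+1 *
  (x ord0 (iu0 k) * (al i a * al i b)
   - f i.+1 (x ord0 (iu i)) * (al i a * be b + be a * al i b)).
Definition chrV0 a b x (i : 'I_k) : R :=
  (2 * derive1 (f i.+1) (x ord0 (iu i)) + 1) * x ord0 (is_ i) * (al i a * al i b)
  + f i.+1 (x ord0 (iu i)) * (al i a * si i b + si i a * al i b).
Definition chrV a b x (i : 'I_k) : R :=
  - x ord0 (is_ i) * (be a * al i b + al i a * be b)
  + f i.+1 (x ord0 (iu i)) * (be a * si i b + si i a * be b)
  - x ord0 (iu0 k) * (al i a * si i b + si i a * al i b).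

(** Koszul's formula with the index lowered. Lowering the proposed vector [vert] and comparing
    avoids computing the inverse metric. *)
Lemma lower_chr a b l x :
  2^-1 * (dgF a b l x + dgF b a l x - dgF l a b x) =
  \sum_m vert (chrS a b x) (chrV0 a b x) (chrV a b x) m * g x m l.
Proof.
rewrite sum_vert /dgF -sumrN -!big_split mulr_sumr /=.
apply: eq_bigr => i _; rewrite gF_s gF_v0 gF_v.
have := eps_sqr i; rewrite /chrS /chrV0 /chrV; set e := eps _ => ee.
have -> : e * (x ord0 (iu0 k) * (al i a * al i b) -
      f i.+1 (x ord0 (iu i)) * (al i a * be b + be a * al i b)) * (e * si i l) =
   (x ord0 (iu0 k) * (al i a * al i b) -
      f i.+1 (x ord0 (iu i)) * (al i a * be b + be a * al i b)) * si i l.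
  by rewrite mulrACA ee mul1r.
by field.
Qed.

Lemma GamE a b m : Gam g a b m =
  (fun x => vert (chrS a b x) (chrV0 a b x) (chrV a b x) m).
Proof.
apply/funext => x; rewrite /Gam mulr_sumr.
under eq_bigr => l _ do rewrite !pd_gF mulrCA lower_chr mulr_sumr.
rewrite exchange_big /= -[RHS](sum_dual m (vert _ _ _)).
apply: eq_bigr => m' _.
(* By symmetry of [g] the contraction is an entry of the inverse matrix times the matrix. *)
have -> : @dual R k m m' = \sum_l ginv g x m l * g x m' l.
  transitivity ((1%:M : 'M[R]_n) m m'); first by rewrite mxE /dual eq_sym.
  rewrite -(mulVmx (gF_unit x)) mxE; apply: eq_bigr => l _.
  by rewrite [RHS]mulrC gF_sym mulrC.
by rewrite mulr_suml; apply: eq_bigr => l _; ring.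
Qed.

End LeviCivita.

(** * The curvature tensor in closed form *)

Section CurvatureForms.
Variables (R : realType) (T : Type).
Implicit Types phi psi : T -> R.

Definition wedge phi psi (a b : T) : R := phi a * psi b - phi b * psi a.

Definition formD al be si (a b c d : T) : R :=
  wedge al be a b * wedge al si c d + wedge al si a b * wedge al be c d.

Definition formE al be (a b c d : T) : R := wedge al be a b * wedge al be c d.

End CurvatureForms.

Section Curvature.
Variables (R : realType) (k : nat).
Notation n := (3 * k).+2.
Variables (f : nat -> R -> R) (eps : nat -> R).
Notation be := (@dual R k (iu0 k)).
Notation al i := (@dual R k (iu i)).
Notation nu0 := (@dual R k (iv0 k)).
Notation nu i := (@dual R k (iv i)).
Notation si i := (@dual R k (is_ i)).
Notation g := (gF f eps).
Implicit Types x : 'rV[R]_n.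
Hypothesis eps_sqr : forall i : 'I_k, eps i.+1 * eps i.+1 = 1.
Hypothesis f_smooth : forall i : 'I_k, smooth (f i.+1).

Let f_derivable (i : 'I_k) t : derivable (f i.+1) t 1.
Proof. exact: (@f_smooth i 0%N t). Qed.
Let f1_derivable (i : 'I_k) t : derivable (derive1 (f i.+1)) t 1.
Proof. exact: (@f_smooth i 1%N t). Qed.

Lemma pd_vert c m x (A B C dA dB dC : 'rV[R]_n -> 'I_k -> R) :
  (forall i, has_deriv x (delta_mx 0 c) (A ^~ i) (dA x i)) ->
  (forall i, has_deriv x (delta_mx 0 c) (B ^~ i) (dB x i)) ->
  (forall i, has_deriv x (delta_mx 0 c) (C ^~ i) (dC x i)) ->
  pd c (fun y => vert (A y) (B y) (C y) m) x = vert (dA x) (dB x) (dC x) m.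
Proof.
move=> hA hB hC; apply: derive_val; rewrite /vert; apply: has_deriv_eq.
  apply: has_deriv_sumf => i.
  repeat first [exact: hA | exact: hB | exact: hC | exact: has_deriv_cstf
    | apply: has_deriv_addf | apply: has_deriv_mulf].
by apply: eq_bigr => i _; ring.
Qed.

(** The derivatives of [chrS], [chrV0], [chrV] along [d_c]. *)
Definition dchrS c a b x (i : 'I_k) : R := eps i.+1 *
  (be c * (al i a * al i b)
   - derive1 (f i.+1) (x ord0 (iu i)) * al i c * (al i a * be b + be a * al i b)).
Definition dchrV0 c a b x (i : 'I_k) : R :=
  2 * derive1 (derive1 (f i.+1)) (x ord0 (iu i)) * al i c * x ord0 (is_ i)
    * (al i a * al i b)
  + (2 * derive1 (f i.+1) (x ord0 (iu i)) + 1) * si i c * (al i a * al i b)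
  + derive1 (f i.+1) (x ord0 (iu i)) * al i c * (al i a * si i b + si i a * al i b).
Definition dchrV c a b x (i : 'I_k) : R :=
  - si i c * (be a * al i b + al i a * be b)
  + derive1 (f i.+1) (x ord0 (iu i)) * al i c * (be a * si i b + si i a * be b)
  - be c * (al i a * si i b + si i a * al i b).

Lemma pd_Gam c a b m x : pd c (Gam g a b m) x =
  vert (dchrS c a b x) (dchrV0 c a b x) (dchrV c a b x) m.
Proof.
rewrite (GamE eps_sqr f_derivable).
have dc j := is_derive_coord c j x.
have df i := is_derive_coord_comp c (@f_derivable i (x ord0 (iu i))).
have df1 i := is_derive_coord_comp c (@f1_derivable i (x ord0 (iu i))).
apply: (@pd_vert c m x (chrS f eps a b) (chrV0 f a b) (chrV f a b)
    (dchrS c a b) (dchrV0 c a b) (dchrV c a b)) => i;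
  (apply: has_deriv_eq;
  [ rewrite /chrS /chrV0 /chrV; repeat first [exact: df1 | exact: df | exact: dc
    | exact: has_deriv_cstf
    | apply: has_deriv_addf | apply: has_deriv_oppf | apply: has_deriv_mulf]
  | rewrite /dchrS /dchrV0 /dchrV /dual; ring ]).
Qed.

Lemma Gam_v0 c p x : Gam g c (iv0 k) p x = 0.
Proof.
rewrite (GamE eps_sqr f_derivable) /vert big1 // => i _.
by rewrite /chrS /chrV0 /chrV /dual !indexE /=; ring.
Qed.

Lemma Gam_v c i p x : Gam g c (iv i) p x = 0.
Proof.
rewrite (GamE eps_sqr f_derivable) /vert big1 // => j _.
by rewrite /chrS /chrV0 /chrV /dual !indexE /=; ring.
Qed.

Lemma Gam_s c i p x : Gam g c (is_ i) p x =
  nu0 p * (f i.+1 (x ord0 (iu i)) * al i c) +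
  nu i p * (f i.+1 (x ord0 (iu i)) * be c - x ord0 (iu0 k) * al i c).
Proof.
rewrite (GamE eps_sqr f_derivable) /vert (@sum_only _ _ i).
  by rewrite /chrS /chrV0 /chrV /dual !indexE /=; ring.
move=> j /negPf ji.
by rewrite /chrS /chrV0 /chrV /dual !indexE [i == j]eq_sym ji /=; ring.
Qed.

(** The fields d_v are parallel, so only the d_s part of the inner derivative is differentiated
    again, and the result has only v-components. *)
Lemma sum_Gam_Gam a b c p x : \sum_m Gam g a b m x * Gam g c m p x =
  vert (fun=> 0) (fun i => chrS f eps a b x i * (f i.+1 (x ord0 (iu i)) * al i c))
    (fun i => chrS f eps a b x i *
       (f i.+1 (x ord0 (iu i)) * be c - x ord0 (iu0 k) * al i c)) p.
Proof.
under eq_bigr => m _ do rewrite (GamE eps_sqr f_derivable).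
rewrite (sum_vert _ _ _ (fun m => Gam g c m p x)); apply: eq_bigr => i _.
by rewrite Gam_v0 Gam_v Gam_s; ring.
Qed.

Lemma RlowE a b c d x : Rlow g a b c d x = \sum_(i < k)
  (- (derive1 (f i.+1) (x ord0 (iu i)) + 1) * formD (al i) be (si i) a b c d
   + - (eps i.+1 * f i.+1 (x ord0 (iu i)) ^+ 2) * formE (al i) be a b c d).
Proof.
rewrite /Rlow.
have RupE p : Rup g a b c p x = vert
  (fun i => dchrS a b c x i - dchrS b a c x i)
  (fun i => dchrV0 a b c x i - dchrV0 b a c x i +
    (chrS f eps b c x i * (f i.+1 (x ord0 (iu i)) * al i a) -
     chrS f eps a c x i * (f i.+1 (x ord0 (iu i)) * al i b)))
  (fun i => dchrV a b c x i - dchrV b a c x i +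
    (chrS f eps b c x i * (f i.+1 (x ord0 (iu i)) * be a - x ord0 (iu0 k) * al i a)
   - chrS f eps a c x i * (f i.+1 (x ord0 (iu i)) * be b - x ord0 (iu0 k) * al i b)))
  p.
  rewrite /Rup !pd_Gam sumrB !sum_Gam_Gam /vert -!sumrB -big_split /=.
  by apply: eq_bigr => i _; ring.
under eq_bigr => p _ do rewrite RupE.
rewrite sum_vert; apply: eq_bigr => i _.
(* One sign comes from [dchrS], the other from lowering d_s. They are gathered in front so that
   [eps_sqr] removes them before [ring]. *)
rewrite gF_s gF_v0 gF_v [X in X + _ + _](_ : _ =
  eps i.+1 * eps i.+1 * (
  (be a * (al i b * al i c)
   - derive1 (f i.+1) (x ord0 (iu i)) * al i a * (al i b * be c + be b * al i c))
  - (be b * (al i a * al i c)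
   - derive1 (f i.+1) (x ord0 (iu i)) * al i b * (al i a * be c + be a * al i c)))
  * si i d); last by rewrite /dchrS; ring.
rewrite eps_sqr /dchrV0 /dchrV /chrS /formD /formE /wedge; ring.
Qed.

End Curvature.

(** * Covariant derivatives of the curvature tensor *)

Section CovariantDerivatives.
Variables (R : realType) (k : nat).
Notation n := (3 * k).+2.
Variables (f : nat -> R -> R) (eps : nat -> R).
Notation be := (@dual R k (iu0 k)).
Notation al i := (@dual R k (iu i)).
Notation si i := (@dual R k (is_ i)).
Notation g := (gF f eps).
Implicit Types x : 'rV[R]_n.
Hypothesis eps_sqr : forall i : 'I_k, eps i.+1 * eps i.+1 = 1.
Hypothesis f_smooth : forall i : 'I_k, smooth (f i.+1).

Let f_derivable (i : 'I_k) t : derivable (f i.+1) t 1.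
Proof. exact: (@f_smooth i 0%N t). Qed.

Definition slot0 {m} : 'I_m.+4 := @Ordinal m.+4 0 isT.
Definition slot1 {m} : 'I_m.+4 := @Ordinal m.+4 1 isT.
Definition slot2 {m} : 'I_m.+4 := @Ordinal m.+4 2 isT.
Definition slot3 {m} : 'I_m.+4 := @Ordinal m.+4 3 isT.

(** All the tensors [nablaR l] of this metric have this shape. *)
Definition curv_tensor m (p q : 'I_k -> R -> R) : tensor R n m.+4 := fun a x =>
  \sum_(i < k) (p i (x ord0 (iu i)) *
       formD (al i) be (si i) (a slot0) (a slot1) (a slot2) (a slot3)
     + q i (x ord0 (iu i)) *
       formE (al i) be (a slot0) (a slot1) (a slot2) (a slot3))
    * \prod_(j < m) al i (a (rshift 4 j)).

Lemma pd_curv_tensor m (p q : 'I_k -> R -> R) a c x :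
  (forall i t, derivable (p i) t 1) -> (forall i t, derivable (q i) t 1) ->
  pd c (@curv_tensor m p q a) x = \sum_(i < k)
   al i c * ((derive1 (p i) (x ord0 (iu i)) *
       formD (al i) be (si i) (a slot0) (a slot1) (a slot2) (a slot3)
     + derive1 (q i) (x ord0 (iu i)) *
       formE (al i) be (a slot0) (a slot1) (a slot2) (a slot3))
    * \prod_(j < m) al i (a (rshift 4 j))).
Proof.
move=> dp dq; apply: derive_val; rewrite /curv_tensor; apply: has_deriv_eq.
  apply: has_deriv_sumf => i; apply: has_deriv_mulf; last exact: has_deriv_cstf.
  apply: has_deriv_addf.
    apply: has_deriv_mulf; last exact: has_deriv_cstf.
    exact: is_derive_coord_comp.
  apply: has_deriv_mulf; last exact: has_deriv_cstf.
  exact: is_derive_coord_comp.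
by apply: eq_bigr => i _; rewrite /dual /=; ring.
Qed.

Definition subst_slot r (a : {ffun 'I_r -> 'I_n}) (p : 'I_r) m :
  {ffun 'I_r -> 'I_n} := [ffun q => if q == p then m else a q].

(** A [curv_tensor] vanishes as soon as one argument is a d_v, so only the d_s part of the
    connection contributes. *)
Lemma sum_Gam_subst m (p q : 'I_k -> R -> R) (a : {ffun 'I_m.+4 -> 'I_n}) s c x :
  \sum_l Gam g c (a s) l x * curv_tensor p q (subst_slot a s l) x =
  \sum_(i < k) chrS f eps c (a s) x i *
    curv_tensor p q (subst_slot a s (is_ i)) x.
Proof.
have tail0 l i (j : 'I_m) : s = rshift 4 j -> al i l = 0 ->
    \prod_(j < m) al i (subst_slot a s l (rshift 4 j)) = 0.
  by move=> -> l0; rewrite (bigD1 j) //= ffunE eqxx l0 mul0r.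
have vanish l : (forall i, al i l = 0) -> (be l = 0) -> (forall i, si i l = 0) ->
    curv_tensor p q (subst_slot a s l) x = 0.
  move=> al0 be0 si0; rewrite /curv_tensor big1 // => i _.
  case: (splitP (s : 'I_(4 + m))) => [j sj|j sj]; last first.
    by rewrite (tail0 _ _ j) ?mulr0 //; exact/val_inj.
  have {sj} sE : s = lshift m j by exact/val_inj.
  rewrite sE /formD /formE /wedge.
  case: j sE => [[|[|[|[|//]]]] ?] _; rewrite !ffunE /= !al0 ?be0 ?si0; ring.
under eq_bigr => l _ do rewrite (GamE eps_sqr f_derivable).
rewrite (sum_vert _ _ _ (fun l => curv_tensor p q (subst_slot a s l) x)).
apply: eq_bigr => i _; rewrite (vanish (iv0 k)) ?(vanish (iv i)) ?mulr0 ?addr0 //;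
  by [move=> *; rewrite /dual indexE | rewrite /dual indexE].
Qed.

Lemma curv_tensor_subst_tail m (p q : 'I_k -> R -> R) (a : {ffun 'I_m.+4 -> 'I_n})
    (j : 'I_m) i x :
  curv_tensor p q (subst_slot a (rshift 4 j) (is_ i)) x = 0.
Proof.
rewrite /curv_tensor big1 // => l _; rewrite (bigD1 j) //=.
have -> : subst_slot a (rshift 4 j) (is_ i) (rshift 4 j) = is_ i.
  by rewrite ffunE eqxx.
by rewrite [al l (is_ i)]/dual indexE mul0r mulr0.
Qed.

Lemma curv_tensor_subst m (p q : 'I_k -> R -> R) (a : {ffun 'I_m.+4 -> 'I_n})
    (s : 'I_4) i x : curv_tensor p q (subst_slot a (lshift m s) (is_ i)) x =
  p i (x ord0 (iu i)) * formD (al i) be (si i)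
     (if s == 0 then is_ i else a slot0) (if s == 1 then is_ i else a slot1)
     (if s == 2%:R then is_ i else a slot2) (if s == 3%:R then is_ i else a slot3)
   * \prod_(j < m) al i (a (rshift 4 j)).
Proof.
have tailE l : \prod_(j < m) al l (subst_slot a (lshift m s) (is_ i) (rshift 4 j)) =
    \prod_(j < m) al l (a (rshift 4 j)).
  apply: eq_bigr => j _; rewrite ffunE; case: eqP => // /(congr1 val) /=.
  by have := ltn_ord s; lia.
rewrite /curv_tensor (@sum_only _ _ i) => [|j /negPf ji]; rewrite tailE;
  case: s tailE => [[|[|[|[|//]]]] ?] _; rewrite !ffunE /= /formD /formE /wedge;
  rewrite /dual !indexE ?[i == j]eq_sym ?ji /=; ring.
Qed.

(** Differentiating the coefficients produces the extra factor [al i]. The connection terms replace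
    [si i] in [formD] by the covector [chrS] with first argument [c]; its multiples of [al i] drop
    out of the wedge with [al i], and the rest turns each of the two summands of [formD] into a
    multiple of [formE]. *)
Lemma cov_deriv_curv_tensor m (p q : 'I_k -> R -> R) :
  (forall i t, derivable (p i) t 1) -> (forall i t, derivable (q i) t 1) ->
  cov_deriv g (@curv_tensor m p q) = curv_tensor (fun i => derive1 (p i))
    (fun i t => derive1 (q i) t + 2 * eps i.+1 * f i.+1 t * p i t).
Proof.
move=> dp dq; apply/funext => a; apply/funext => x; rewrite /cov_deriv.
set c := a ord_max; set a' : {ffun _ -> _} := [ffun _ => _].
rewrite pd_curv_tensor //.
under [X in _ - X]eq_bigr => s _ do rewrite (sum_Gam_subst p q a' s c x).
rewrite (@big_split_ord _ _ _ 4 m) /= [X in _ - (_ + X)]big1 ?addr0; last first.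
  by move=> j _; rewrite big1 // => i _; rewrite curv_tensor_subst_tail mulr0.
rewrite exchange_big -sumrB /=; apply: eq_bigr => i _.
under [X in _ - X]eq_bigr => s _ do rewrite (curv_tensor_subst p q a' s i x).
have -> : \prod_(j < m.+1) al i (a (rshift 4 j)) =
    \prod_(j < m) al i (a' (rshift 4 j)) * al i c.
  rewrite big_ord_recr; congr (_ * al i (a _)); last exact/val_inj.
  apply: eq_bigr => j _; rewrite ffunE; congr (al i (a _)); exact/val_inj.
have a's (s : 'I_m.+4) (s' : 'I_m.+1.+4) : s = s' :> nat -> a' s = a s'.
  by move=> ss'; rewrite ffunE; congr (a _); exact/val_inj.
set t := \prod_(j < m) _; rewrite !big_ord_recl big_ord0 /=.
rewrite (a's slot0 slot0) // (a's slot1 slot1) // (a's slot2 slot2) //.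
rewrite (a's slot3 slot3) //.
rewrite (a's (@lshift 4 m _) slot0) // (a's (@lshift 4 m _) slot1) //.
rewrite (a's (@lshift 4 m _) slot2) // (a's (@lshift 4 m _) slot3) //.
have al_s : al i (is_ i) = 0 by rewrite /dual indexE.
have be_s : be (is_ i) = 0 by rewrite /dual indexE.
have si_s : si i (is_ i) = 1 by rewrite /dual eqxx.
by rewrite /formD /formE /wedge /chrS al_s be_s si_s; ring.
Qed.

Lemma has_deriv_derive1n (h : R -> R) l (t : R) : smooth h ->
  has_deriv t 1 (derive1n l h) (derive1n l.+1 h t).
Proof. by move=> sh; split; [exact: sh | rewrite derive1nS derive1E]. Qed.

Lemma has_deriv_derive1 (h : R -> R) (t a : R) : has_deriv t 1 h a -> derive1 h t = a.
Proof. by move=> ha; rewrite derive1E; exact: derive_val. Qed.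

(** The simplified value of q' + 2 eps f p for the coefficients p and q of the curvature tensor
    itself. *)
Definition curv_q1 (i : 'I_k) (t : R) : R :=
  - (2 * eps i.+1 * f i.+1 t * (2 * derive1n 1 (f i.+1) t + 1)).

Lemma RtensorE : Rtensor g = @curv_tensor 0
  (fun i t => - (derive1n 1 (f i.+1) t + 1))
  (fun i t => - (eps i.+1 * f i.+1 t ^+ 2)).
Proof.
apply/funext => a; apply/funext => x; rewrite /Rtensor (RlowE eps_sqr f_smooth).
apply: eq_bigr => i _; rewrite big_ord0 mulr1.
have -> : (2%:R : 'I_4) = slot2 by exact/val_inj.
have -> : (3%:R : 'I_4) = slot3 by exact/val_inj.
have -> : (0 : 'I_4) = slot0 by exact/val_inj.
by have -> : (1 : 'I_4) = slot1 by exact/val_inj.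
Qed.

Let df i l (t : R) := has_deriv_derive1n l t (@f_smooth i).

Ltac deriv_tac := repeat first [exact: (df _ 0) | exact: df
  | exact: has_deriv_cstf | apply: has_deriv_addf | apply: has_deriv_oppf
  | apply: has_deriv_mulf].

Lemma nablaR1E : nablaR g (l := 1) = @curv_tensor 1
  (fun i t => - derive1n 2 (f i.+1) t) curv_q1.
Proof.
rewrite /= RtensorE cov_deriv_curv_tensor.
- congr curv_tensor; apply/funext => i; apply/funext => t.
    apply: has_deriv_derive1; apply: has_deriv_eq; first by deriv_tac.
    by rewrite addr0.
  rewrite (@has_deriv_derive1 _ _
    (- (eps i.+1 * (2 * f i.+1 t * derive1n 1 (f i.+1) t)))) /curv_q1.
    by ring.
  by apply: has_deriv_eq; [deriv_tac | rewrite /=; ring].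
- move=> i t; suff [] : has_deriv t 1 (fun t => - (derive1n 1 (f i.+1) t + 1))
    (- (derive1n 2 (f i.+1) t + 0)) by [].
  by deriv_tac.
- move=> i t; suff [] : has_deriv t 1 (fun t => - (eps i.+1 * f i.+1 t ^+ 2))
    (- (eps i.+1 * (2 * f i.+1 t * derive1n 1 (f i.+1) t))) by [].
  by apply: has_deriv_eq; [deriv_tac | rewrite /=; ring].
Qed.

Definition curv_q2 (i : 'I_k) (t : R) : R :=
  derive1 (curv_q1 i) t + 2 * eps i.+1 * f i.+1 t * - derive1n 2 (f i.+1) t.

Lemma nablaR2E : nablaR g (l := 2) = @curv_tensor 2
  (fun i t => - derive1n 3 (f i.+1) t) curv_q2.
Proof.
have -> : nablaR g (l := 2) = cov_deriv g (nablaR g (l := 1)) by [].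
rewrite nablaR1E.
rewrite cov_deriv_curv_tensor.
- congr curv_tensor; apply/funext => i; apply/funext => t.
  by apply: has_deriv_derive1; deriv_tac.
- move=> i t; suff [] : has_deriv t 1 (fun t => - derive1n 2 (f i.+1) t)
    (- derive1n 3 (f i.+1) t) by [].
  by deriv_tac.
- move=> i t; suff [] : has_deriv t 1 (curv_q1 i)
    (- (2 * eps i.+1 * (derive1n 1 (f i.+1) t * (2 * derive1n 1 (f i.+1) t + 1)
      + f i.+1 t * (2 * derive1n 2 (f i.+1) t)))) by [].
  by apply: has_deriv_eq; [deriv_tac | rewrite /=; ring].
Qed.

End CovariantDerivatives.

(** * Curvature-preserving isometries *)

Section Evaluation.
Variables (R : realType) (n : nat).

Definition ev r (T : {ffun 'I_r -> 'I_n} -> R) (X : 'I_r -> 'cV[R]_n) : R :=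
  \sum_(b : {ffun 'I_r -> 'I_n}) (\prod_(s < r) X s (b s) 0) * T b.

(** Passes from components to vectors: expanding each component of [A *m X s] distributes the
    product over all multi-indices. *)
Lemma ev_pullback r (A : 'M[R]_n) (T T' : {ffun 'I_r -> 'I_n} -> R) X :
  (forall a, pullback A T' a = T a) -> ev T X = ev T' (fun s => A *m X s).
Proof.
move=> TE; rewrite /ev.
under eq_bigr => a _ do rewrite -TE /pullback mulr_sumr.
rewrite exchange_big; apply: eq_bigr => b _ /=.
under [in RHS]eq_bigr => s _ do rewrite mxE.
rewrite bigA_distr_bigA mulr_suml; apply: eq_bigr => a _.
rewrite mulrA -big_split; congr (_ * _).
by apply: eq_bigr => s _; rewrite mulrC.
Qed.

Lemma ev_sum r m (T : 'I_m -> {ffun 'I_r -> 'I_n} -> R) X :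
  ev (fun b => \sum_i T i b) X = \sum_i ev (T i) X.
Proof.
rewrite /ev exchange_big; apply: eq_bigr => b _ /=; exact: mulr_sumr.
Qed.

Lemma evD r (T T' : {ffun 'I_r -> 'I_n} -> R) X :
  ev (fun b => T b + T' b) X = ev T X + ev T' X.
Proof. by rewrite -big_split; apply: eq_bigr => b _ /=; rewrite mulrDr. Qed.

Lemma evZ r c (T : {ffun 'I_r -> 'I_n} -> R) X :
  ev (fun b => c * T b) X = c * ev T X.
Proof. by rewrite mulr_sumr; apply: eq_bigr => b _ /=; rewrite mulrCA. Qed.

Lemma ev_prod r (phi : 'I_r -> 'I_n -> R) X :
  ev (fun b : {ffun 'I_r -> 'I_n} => \prod_s phi s (b s)) X = \prod_s \sum_j phi s j * X s j 0.
Proof.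
rewrite bigA_distr_bigA; apply: eq_bigr => b _.
by rewrite mulrC -big_split.
Qed.

(** The default value [phi] of [nth] serves all slots after the fourth, giving the uniform product
    over slots required by [ev_prod]. *)
Lemma prod_slots (T : Type) m (phi c0 c1 c2 c3 : T -> R) (X : 'I_m.+4 -> T) :
  \prod_(s < m.+4) nth phi [:: c0; c1; c2; c3] s (X s) =
  c0 (X slot0) * c1 (X slot1) * c2 (X slot2) * c3 (X slot3) *
  \prod_(j < m) phi (X (rshift 4 j)).
Proof.
rewrite (@big_split_ord _ _ _ 4 m) /= !big_ord_recl big_ord0 /= mulr1 !mulrA.
congr (_ * _); first by do 3?congr (_ * _); congr (_ (X _)); apply: val_inj.
by apply: eq_bigr => j _; rewrite nth_default.
Qed.

End Evaluation.

(** * Curvature tensors evaluated on tangent vectors *)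

Section CurvatureOnVectors.
Variables (R : realType) (k : nat).
Notation n := (3 * k).+2.
Variables (f : nat -> R -> R) (eps : nat -> R).
Notation g := (gF f eps).
Implicit Types x : 'rV[R]_n.

Definition comp (j : 'I_n) (X : 'cV[R]_n) : R := X j 0.
Notation be := (comp (iu0 k)).
Notation al i := (comp (iu i)).
Notation si i := (comp (is_ i)).

Let ev4 m (j j0 j1 j2 j3 : 'I_n) (X : 'I_m.+4 -> 'cV[R]_n) :
  ev (fun b : {ffun 'I_m.+4 -> 'I_n} =>
    @dual R k j0 (b slot0) * @dual R k j1 (b slot1) * @dual R k j2 (b slot2) *
    @dual R k j3 (b slot3) * \prod_(l < m) @dual R k j (b (rshift 4 l))) X =
  comp j0 (X slot0) * comp j1 (X slot1) * comp j2 (X slot2) * comp j3 (X slot3) *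
    \prod_(l < m) comp j (X (rshift 4 l)).
Proof.
rewrite -[RHS](@prod_slots R 'cV[R]_n m (comp j)).
have -> : (fun b : {ffun 'I_m.+4 -> 'I_n} =>
    @dual R k j0 (b slot0) * @dual R k j1 (b slot1) * @dual R k j2 (b slot2) *
    @dual R k j3 (b slot3) * \prod_(l < m) @dual R k j (b (rshift 4 l))) =
  fun b : {ffun 'I_m.+4 -> 'I_n} => \prod_(s < m.+4)
    nth (@dual R k j) [:: dual R j0; dual R j1; dual R j2; dual R j3] s (b s).
  apply/funext => b.
  by rewrite (@prod_slots R _ m (@dual R k j) _ _ _ _ (fun s => b s)).
rewrite (@ev_prod R n m.+4 (fun s =>
  nth (dual R j) [:: dual R j0; dual R j1; dual R j2; dual R j3] s)).
apply: eq_bigr => -[[|[|[|[|s]]]] hs] _ /=; try exact: (sum_dual _ (fun l => X _ l 0)).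
by rewrite !nth_nil; exact: (sum_dual _ (fun l => X _ l 0)).
Qed.

Lemma ev_curv_tensor m (p q : 'I_k -> R -> R) x (X : 'I_m.+4 -> 'cV[R]_n) :
  ev (fun b => curv_tensor p q b x) X = \sum_(i < k)
   (p i (x ord0 (iu i)) *
      formD (al i) be (si i) (X slot0) (X slot1) (X slot2) (X slot3)
    + q i (x ord0 (iu i)) *
      formE (al i) be (X slot0) (X slot1) (X slot2) (X slot3))
   * \prod_(j < m) al i (X (rshift 4 j)).
Proof.
rewrite /curv_tensor ev_sum; apply: eq_bigr => i _.
set p_ := p i _; set q_ := q i _.
pose M (j0 j1 j2 j3 : 'I_n) (b : {ffun 'I_m.+4 -> 'I_n}) :=
  @dual R k j0 (b slot0) * @dual R k j1 (b slot1) * @dual R k j2 (b slot2) *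
  @dual R k j3 (b slot3) * \prod_(l < m) @dual R k (iu i) (b (rshift 4 l)).
pose a := iu i; pose b0 := iu0 k; pose s := is_ i.
(* [formD] expands into eight monomials and [formE] into four, each a product of covectors to which
   [ev4] applies. *)
transitivity (ev (fun b =>
  p_ * (M a b0 a s b + M b0 a s a b + M a s a b0 b + M s a b0 a b
        + -1 * (M a b0 s a b + M b0 a a s b + M a s b0 a b + M s a a b0 b))
  + q_ * (M a b0 a b0 b + M b0 a b0 a b + -1 * (M a b0 b0 a b + M b0 a a b0 b))) X).
  congr (ev _ _); apply/funext => b.
  by rewrite /M /formD /formE /wedge /a /b0 /s; ring.
rewrite !(evD, evZ) /M !ev4 /formD /formE /wedge /a /b0 /s; ring.
Qed.

End CurvatureOnVectors.

(** * Curvature homogeneity as invariance of multilinear forms *)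

Section Isometries.
Variables (R : realType) (k : nat).
Notation n := (3 * k).+2.
Variables (f : nat -> R -> R) (eps : nat -> R).
Notation g := (gF f eps).
Notation be := (comp (iu0 k)).
Notation al i := (comp (iu i)).
Notation si i := (comp (is_ i)).
Implicit Types (x P Q : 'rV[R]_n) (X Y Z W U V S : 'cV[R]_n) (A B : 'M[R]_n).
Hypothesis eps_sqr : forall i : 'I_k, eps i.+1 * eps i.+1 = 1.
Hypothesis f_smooth : forall i : 'I_k, smooth (f i.+1).

Definition bas (j : 'I_n) : 'cV[R]_n := delta_mx j 0.

Lemma comp_bas j l : comp j (bas l) = (j == l)%:R.
Proof. by rewrite /comp mxE eqxx andbT. Qed.

Lemma mulmx_bas (C : 'M[R]_n) X j : comp j (C *m X) =
  \sum_l comp j (C *m bas l) * comp l X.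
Proof.
by rewrite {1}/comp mxE; apply: eq_bigr => l _; rewrite /comp /bas -colE mxE.
Qed.

Definition metric x X Y : R := \sum_b (\sum_a X a 0 * g x a b) * Y b 0.

Lemma metricE x X Y : metric x X Y = (X^T *m g x *m Y) 0 0.
Proof.
rewrite mxE; apply: eq_bigr => b _; rewrite [in RHS]mxE; congr (_ * _).
by apply: eq_bigr => a _; rewrite [X^T _ _]mxE.
Qed.

Lemma sum_comp X j : \sum_a X a 0 * dual R j a = comp j X.
Proof. by rewrite /comp -(sum_dual j (X ^~ 0)); apply: eq_bigr => a _; rewrite mulrC. Qed.

Lemma sum_metric_v0 x X : \sum_a X a 0 * g x a (iv0 k) = be X.
Proof.
by rewrite -[RHS]sum_comp; apply: eq_bigr => a _; rewrite gF_sym gF_v0.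
Qed.

Lemma sum_metric_v x X i : \sum_a X a 0 * g x a (iv i) = al i X.
Proof.
by rewrite -[RHS]sum_comp; apply: eq_bigr => a _; rewrite gF_sym gF_v.
Qed.

Lemma sum_metric_s x X i : \sum_a X a 0 * g x a (is_ i) = eps i.+1 * si i X.
Proof.
rewrite -[si i X]sum_comp mulr_sumr; apply: eq_bigr => a _.
by rewrite gF_sym gF_s mulrCA.
Qed.

Lemma metric_bas x X j : metric x X (bas j) = \sum_a X a 0 * g x a j.
Proof.
rewrite /metric (bigD1 j) //= [X in _ + X]big1 => [|l /negPf lj].
  by rewrite [bas j _ _]mxE !eqxx mulr1 addr0.
by rewrite [bas j _ _]mxE lj mulr0.
Qed.

Definition u_zero X := be X = 0 /\ forall i, al i X = 0.
Definition us_zero X := u_zero X /\ forall i, si i X = 0.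

Lemma metric_u_zero x X Y : u_zero X -> u_zero Y ->
  metric x X Y = \sum_(i < k) eps i.+1 * (si i X * si i Y).
Proof.
move=> [X0 Xu] [Y0 Yu].
transitivity (\sum_b \sum_(i < k) eps i.+1 * si i X * (Y b 0 * dual R (is_ i) b)).
  apply: eq_bigr => b _; case: (@indexP k b) => [|i||i|i].
  - by rewrite [Y _ _]Y0 mulr0 big1 // => i _; rewrite mul0r mulr0.
  - by rewrite [Y _ _]Yu mulr0 big1 // => j _; rewrite mul0r mulr0.
  - rewrite sum_metric_v0 X0 mul0r big1 // => i _.
    by rewrite /dual indexE !mulr0.
  - rewrite sum_metric_v Xu mul0r big1 // => j _.
    by rewrite /dual indexE !mulr0.
  - rewrite sum_metric_s (@sum_only _ _ i) => [|j /negPf ji].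
      by rewrite /dual eqxx mulr1.
    by rewrite /dual indexE [i == j]eq_sym ji !mulr0.
rewrite exchange_big; apply: eq_bigr => i _ /=.
by rewrite -mulr_sumr sum_comp mulrA.
Qed.

(** [nablaR] evaluated on vectors; [h] collects the arguments beyond the fourth. *)
Definition crv (p q h : 'I_k -> R) X Y Z W : R := \sum_(i < k)
  (p i * formD (al i) be (si i) X Y Z W + q i * formE (al i) be X Y Z W) * h i.

(** Suitable triples of basis vectors isolate [be X], then [al i X], then [si i X], each with the
    nonzero factor [p i] up to sign. *)
Lemma crv_ker (p q : 'I_k -> R) X : (forall i, p i != 0) ->
  (exists i : 'I_k, true) ->
  (forall Y Z W, crv p q (fun=> 1) X Y Z W = 0) -> us_zero X.
Proof.
move=> p0 [i0 _] X0.
have crv_iis i : p i * - be X = 0.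
  rewrite -(X0 (bas (iu i)) (bas (iu i)) (bas (is_ i))) /crv (@sum_only _ _ i).
    by rewrite /formD /formE /wedge !comp_bas !indexE /=; ring.
  move=> j /negPf ji.
  by rewrite /formD /formE /wedge !comp_bas !indexE ji /=; ring.
have be0 : be X = 0.
  have /eqP := crv_iis i0.
  by rewrite mulf_eq0 (negPf (p0 _)) oppr_eq0 => /eqP.
have al0 i : al i X = 0.
  apply: (mulfI (p0 i)); rewrite mulr0.
  rewrite -(X0 (bas (iu0 k)) (bas (iu i)) (bas (is_ i))) /crv (@sum_only _ _ i).
    by rewrite /formD /formE /wedge !comp_bas !indexE /=; ring.
  move=> j /negPf ji.
  by rewrite /formD /formE /wedge !comp_bas !indexE ji /=; ring.
split=> // i.
apply: (mulfI (p0 i)); rewrite mulr0; apply: oppr_inj; rewrite oppr0.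
rewrite -(X0 (bas (iu i)) (bas (iu i)) (bas (iu0 k))) /crv (@sum_only _ _ i).
  by rewrite /formD /formE /wedge !comp_bas !indexE be0 al0 /=; ring.
move=> j /negPf ji.
by rewrite /formD /formE /wedge !comp_bas !indexE ji /=; ring.
Qed.

Lemma crv_us_zero (p q h : 'I_k -> R) X Y Z W : us_zero X -> crv p q h X Y Z W = 0.
Proof.
move=> [[be0 al0] si0]; rewrite /crv big1 // => i _.
by rewrite /formD /formE /wedge be0 al0 si0; ring.
Qed.

Lemma crv_u_zero (p q h : 'I_k -> R) X Y Z W : u_zero X -> crv p q h X Y Z W =
  - \sum_(i < k) p i * si i X * al i Y * wedge (al i) be Z W * h i.
Proof.
move=> [be0 al0]; rewrite /crv -sumrN; apply: eq_bigr => i _.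
by rewrite /formD /formE /wedge be0 al0; ring.
Qed.

Definition coefD0 x (i : 'I_k) := - (derive1n 1 (f i.+1) (x ord0 (iu i)) + 1).
Definition coefE0 x (i : 'I_k) := - (eps i.+1 * f i.+1 (x ord0 (iu i)) ^+ 2).
Definition coefD1 x (i : 'I_k) := - derive1n 2 (f i.+1) (x ord0 (iu i)).
Definition coefE1 x (i : 'I_k) := curv_q1 f eps i (x ord0 (iu i)).
Definition coefD2 x (i : 'I_k) := - derive1n 3 (f i.+1) (x ord0 (iu i)).
Definition coefE2 x (i : 'I_k) := curv_q2 f eps i (x ord0 (iu i)).

(** The last clause fills both derivative slots of the second covariant derivative with the same
    vector [V]. *)
Definition preserves P Q A : Prop :=
  [/\ forall X Y, metric P X Y = metric Q (A *m X) (A *m Y),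
      forall X Y Z W, crv (coefD0 P) (coefE0 P) (fun=> 1) X Y Z W =
        crv (coefD0 Q) (coefE0 Q) (fun=> 1) (A *m X) (A *m Y) (A *m Z) (A *m W),
      forall X Y Z W V, crv (coefD1 P) (coefE1 P) (fun i => al i V) X Y Z W =
        crv (coefD1 Q) (coefE1 Q) (fun i => al i (A *m V))
          (A *m X) (A *m Y) (A *m Z) (A *m W)
    & forall X Y Z W V, crv (coefD2 P) (coefE2 P) (fun i => al i V * al i V) X Y Z W =
        crv (coefD2 Q) (coefE2 Q) (fun i => al i (A *m V) * al i (A *m V))
          (A *m X) (A *m Y) (A *m Z) (A *m W)].

Lemma pullback_curv_tensor m (p q : 'I_k -> R -> R) P Q A :
  (forall a : {ffun 'I_m.+4 -> 'I_n},
     pullback A (fun b => curv_tensor p q b Q) a = curv_tensor p q a P) ->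
  forall U : 'I_m.+4 -> 'cV[R]_n,
  crv (fun i => p i (P ord0 (iu i))) (fun i => q i (P ord0 (iu i)))
    (fun i => \prod_(j < m) al i (U (rshift 4 j)))
    (U slot0) (U slot1) (U slot2) (U slot3) =
  crv (fun i => p i (Q ord0 (iu i))) (fun i => q i (Q ord0 (iu i)))
    (fun i => \prod_(j < m) al i (A *m U (rshift 4 j)))
    (A *m U slot0) (A *m U slot1) (A *m U slot2) (A *m U slot3).
Proof. by move=> RA U; have := ev_pullback U RA; rewrite !ev_curv_tensor. Qed.

Lemma curv_homogeneous_preserves P Q : curv_homogeneous (@gF R k f eps) 2 ->
  exists A B, A *m B = 1%:M /\ preserves P Q A.
Proof.
move=> /(_ P Q) [A [gA RA]].
(* The metric at [P] is invertible and has [A] as a factor. *)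
have A_unit : A \in unitmx.
  by have := gF_unit f eps_sqr P; rewrite -gA unitmx_mul => /andP[].
exists A, (invmx A); split; first exact: mulmxV.
split.
- by move=> X Y; rewrite !metricE -gA trmx_mul !mulmxA.
- move=> X Y Z W.
  have := RA 0%N isT; rewrite /nablaR (RtensorE eps_sqr f_smooth).
  move=> /pullback_curv_tensor/(_ (nth 0 [:: X; Y; Z; W] \o val)).
  have h0 (V : 'I_0 -> 'cV[R]_n) : (fun i => \prod_(j < 0) al i (V j)) = fun=> 1.
    by apply/funext => i; rewrite big_ord0.
  by rewrite (h0 (fun j => _ (rshift 4 j))) (h0 (fun j => A *m _ (rshift 4 j))).
- move=> X Y Z W V.
  have := RA 1%N isT; rewrite (nablaR1E eps_sqr f_smooth).
  move=> /pullback_curv_tensor/(_ (nth 0 [:: X; Y; Z; W; V] \o val)).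
  have h1 (U : 'I_1 -> 'cV[R]_n) :
      (fun i => \prod_(j < 1) al i (U j)) = fun i => al i (U ord0).
    by apply/funext => i; rewrite big_ord1.
  by rewrite (h1 (fun j => _ (rshift 4 j))) (h1 (fun j => A *m _ (rshift 4 j))).
- move=> X Y Z W V.
  have := RA 2%N isT; rewrite (nablaR2E eps_sqr f_smooth).
  move=> /pullback_curv_tensor/(_ (nth 0 [:: X; Y; Z; W; V; V] \o val)).
  have h2 (U : 'I_2 -> 'cV[R]_n) : (fun i => \prod_(j < 2) al i (U j)) =
      fun i => al i (U ord0) * al i (U (lift ord0 ord0)).
    by apply/funext => i; rewrite !big_ord_recl big_ord0 mulr1.
  by rewrite (h2 (fun j => _ (rshift 4 j))) (h2 (fun j => A *m _ (rshift 4 j))).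
Qed.

End Isometries.

(** * Shape of the isometries and their scalar invariants *)

Section IsometryAlgebra.
Variables (R : realType) (k : nat).
Notation n := (3 * k).+2.
Variables (f : nat -> R -> R) (eps : nat -> R).
Notation be := (comp (iu0 k)).
Notation al i := (comp (iu i)).
Notation si i := (comp (is_ i)).
Notation bas := (@bas R k).
Implicit Types (X Y Z W V S : 'cV[R]_n).
Hypothesis eps_sqr : forall i : 'I_k, eps i.+1 * eps i.+1 = 1.

(** [B] maps the tangent space at [Q] to that at [P], with inverse [A]; primed coefficients belong
    to [Q], unprimed ones to [P]. *)
Variables (P Q : 'rV[R]_n) (A B : 'M[R]_n).
Variables (p0 q0 p1 q1 p2 q2 p0' q0' p1' q1' p2' q2' : 'I_k -> R).
Hypothesis BA : B *m A = 1%:M.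
Hypotheses (p0_neq0 : forall i, p0 i != 0) (p0'_neq0 : forall i, p0' i != 0).
Hypothesis metricB : forall X Y,
  metric f eps Q X Y = metric f eps P (B *m X) (B *m Y).
Hypothesis crv0B : forall X Y Z W, crv p0' q0' (fun=> 1) X Y Z W =
  crv p0 q0 (fun=> 1) (B *m X) (B *m Y) (B *m Z) (B *m W).
Hypothesis crv1B : forall X Y Z W V, crv p1' q1' (fun i => al i V) X Y Z W =
  crv p1 q1 (fun i => al i (B *m V)) (B *m X) (B *m Y) (B *m Z) (B *m W).
Hypothesis crv2B : forall X Y Z W V,
  crv p2' q2' (fun i => al i V * al i V) X Y Z W =
  crv p2 q2 (fun i => al i (B *m V) * al i (B *m V))
    (B *m X) (B *m Y) (B *m Z) (B *m W).

Let mulBA X : B *m (A *m X) = X. Proof. by rewrite mulmxA BA mul1mx. Qed.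

(** [us_zero] is the kernel of the curvature tensor and [u_zero] its orthogonal
    complement, so both are preserved. *)
Lemma us_zeroA X : 'I_k -> us_zero X -> us_zero (A *m X).
Proof.
move=> i X0; apply: (crv_ker (q := q0') p0'_neq0) => [|Y Z W]; first by exists i.
by rewrite crv0B mulBA crv_us_zero.
Qed.

Lemma us_zeroB X : 'I_k -> us_zero X -> us_zero (B *m X).
Proof.
move=> i X0; apply: (crv_ker (q := q0) p0_neq0) => [|Y Z W]; first by exists i.
by rewrite -(mulBA Y) -(mulBA Z) -(mulBA W) -crv0B crv_us_zero.
Qed.

Lemma us_zero_v0 : us_zero (bas (iv0 k)).
Proof. by split; [split=> [|i]|move=> i]; rewrite comp_bas indexE. Qed.

Lemma us_zero_v i : us_zero (bas (iv i)).
Proof. by split; [split=> [|j]|move=> j]; rewrite comp_bas indexE. Qed.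

Lemma u_zero_s i : u_zero (bas (is_ i)).
Proof. by split=> [|j]; rewrite comp_bas indexE. Qed.

Lemma metric_us_zero x X Y : u_zero X -> us_zero Y -> metric f eps x X Y = 0.
Proof.
move=> X0 [Y0 Ys]; rewrite metric_u_zero // big1 // => i _.
by rewrite Ys !mulr0.
Qed.

(** Pairing with the d_v, which lie in the kernel, reads off the u-components. *)
Lemma u_zeroP x X : (forall Y, us_zero Y -> metric f eps x X Y = 0) -> u_zero X.
Proof.
move=> X0; split=> [|i].
  by rewrite -(sum_metric_v0 f eps x) -metric_bas X0 //; exact: us_zero_v0.
by rewrite -(sum_metric_v f eps x) -metric_bas X0 //; exact: us_zero_v.
Qed.

Lemma u_zeroA X : 'I_k -> u_zero X -> u_zero (A *m X).
Proof.
move=> i X0; apply: (@u_zeroP Q) => Y Y0.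
by rewrite metricB mulBA metric_us_zero //; exact: us_zeroB.
Qed.

Lemma u_zeroB X : 'I_k -> u_zero X -> u_zero (B *m X).
Proof.
move=> i X0; apply: (@u_zeroP P) => Y Y0.
by rewrite -(mulBA Y) -metricB metric_us_zero //; exact: us_zeroA.
Qed.

Lemma crv_s (p q h : 'I_k -> R) i Y Z W : crv p q h (bas (is_ i)) Y Z W =
  - (p i * al i Y * wedge (al i) be Z W * h i).
Proof.
rewrite crv_u_zero; last exact: u_zero_s.
congr (- _); rewrite (@sum_only _ _ i) => [|j /negPf ji].
  by rewrite comp_bas eqxx /=; ring.
by rewrite comp_bas indexE ji /=; ring.
Qed.

Lemma crv_u_zero_bas (p q h : 'I_k -> R) S l m : u_zero S ->
  crv p q h S (bas (iu m)) (bas (iu l)) (bas (iu0 k)) =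
  - ((m == l)%:R * (p l * si l S * h l)).
Proof.
move=> S0; rewrite crv_u_zero //; congr (- _).
rewrite (@sum_only _ _ l) => [|j /negPf jl].
  by rewrite /wedge !comp_bas !indexE [l == m]eq_sym /=; ring.
by rewrite /wedge !comp_bas !indexE jl /=; ring.
Qed.

(** The image [S] of [d_(s_(i+1))] is a combination of the [d_s]'s; inserting it in the
    first slot of [R] shows that only one of its coefficients is nonzero. *)
Lemma alB_multiple i : exists l a O, let b := be (B *m bas (iu0 k)) in
  [/\ a != 0, b != 0, forall X, al i (B *m X) = a * al l X,
      eps l.+1 * O ^+ 2 = eps i.+1
    & [/\ p0' l * O = p0 i * a ^+ 2 * b, p1' l * O = p1 i * a ^+ 3 * b
        & p2' l * O = p2 i * a ^+ 4 * b]].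
Proof.
pose S := A *m bas (is_ i); have S0 : u_zero S.
  exact/(u_zeroA i)/u_zero_s.
have BS : B *m S = bas (is_ i) by exact: mulBA.
have normS : \sum_(j < k) eps j.+1 * (si j S * si j S) = eps i.+1.
  rewrite -(metric_u_zero f eps Q) // metricB BS (metric_u_zero f eps P);
    [|exact: u_zero_s..].
  rewrite (@sum_only _ _ i) => [|j /negPf ji]; rewrite !comp_bas !indexE /=.
    by ring.
  by rewrite ji /=; ring.
(* Otherwise the squared norm of [S], which is the sign [eps i.+1], would vanish. *)
have [l Ol] : exists l, si l S != 0.
  apply/existsP; apply: contraT; rewrite negb_exists => /forallP S00.
  have := eps_neq0 eps_sqr i; rewrite -normS big1 ?eqxx // => j _.
  by have := S00 j; rewrite negbK => /eqP ->; rewrite !mulr0.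
pose aj j := al i (B *m bas (iu j)).
pose q := al i (B *m bas (iu0 k)); set b := be (B *m bas (iu0 k)).
pose bl := be (B *m bas (iu l)).
have w_l : wedge (al i) be (B *m bas (iu l)) (B *m bas (iu0 k)) = aj l * b - q * bl.
  by [].
have E_l : p0' l * si l S = p0 i * aj l * (aj l * b - q * bl).
  have := crv0B S (bas (iu l)) (bas (iu l)) (bas (iu0 k)).
  rewrite BS crv_s crv_u_zero_bas // w_l eqxx mul1r !mulr1.
  by move/oppr_inj.
have aw_neq0 : aj l * (aj l * b - q * bl) != 0.
  have : p0' l * si l S != 0 by rewrite mulf_neq0.
  by rewrite E_l -mulrA mulf_eq0 negb_or => /andP[].
(* With d_(u_0) in the second slot the side at [Q] vanishes, while the side at [P] is [q] times
   nonzero factors. *)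
have q_eq0 : q = 0.
  have := crv0B S (bas (iu0 k)) (bas (iu l)) (bas (iu0 k)).
  rewrite BS crv_s crv_u_zero // w_l big1 => [/eqP|j _]; last first.
    by rewrite comp_bas indexE /=; ring.
  rewrite eq_sym oppr0 oppr_eq0 !mulf_eq0 oner_eq0 orbF (negPf (p0_neq0 i)) /=.
  case/orP=> [/eqP //|/eqP w0].
  by move: aw_neq0; rewrite w0 mulr0 eqxx.
move: aw_neq0; rewrite q_eq0 mul0r subr0 !mulf_eq0 !negb_or => /and3P[al_neq0 _ b_neq0].
(* Different u-indices in the second and third slots make the side at [Q] vanish. *)
have aj0 j : j != l -> aj j = 0.
  move=> /negPf jl.
  have := crv0B S (bas (iu j)) (bas (iu l)) (bas (iu0 k)).
  rewrite BS crv_s crv_u_zero_bas // w_l jl mul0r q_eq0 mul0r subr0 mulr1.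
  move/oppr_inj/esym/eqP; rewrite !mulf_eq0 (negPf (p0_neq0 i)) (negPf al_neq0).
  by rewrite (negPf b_neq0) !orbF => /eqP.
have Oj0 j : j != l -> si j S = 0.
  move=> jl; have := crv0B S (bas (iu j)) (bas (iu j)) (bas (iu0 k)).
  rewrite BS crv_s crv_u_zero_bas // -/(aj j) aj0 // eqxx mulr0 !mul0r mul1r mulr1.
  by move/oppr_inj/eqP; rewrite mulf_eq0 (negPf (p0'_neq0 j)) => /eqP.
exists l, (aj l), (si l S); split=> //.
- move=> X; rewrite mulmx_bas (bigD1 (iu l)) //= big1 ?addr0 // => m.
  case: (@indexP k m) => [_|j|_|j _|j _].
  + by rewrite -/q q_eq0 mul0r.
  + by rewrite iu_eq => jl; rewrite -/(aj j) aj0 // mul0r.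
  + by have [[_ ->] _] := us_zeroB i us_zero_v0; rewrite mul0r.
  + by have [[_ ->] _] := us_zeroB i (us_zero_v j); rewrite mul0r.
  + by have [_ ->] := u_zeroB i (u_zero_s j); rewrite mul0r.
- by rewrite -normS (@sum_only _ _ l) => [|j /Oj0 ->]; [rewrite expr2|rewrite !mulr0].
split.
- by rewrite E_l q_eq0; ring.
- have := crv1B S (bas (iu l)) (bas (iu l)) (bas (iu0 k)) (bas (iu l)).
  rewrite BS crv_s crv_u_zero_bas // w_l comp_bas !eqxx mul1r q_eq0.
  rewrite mulr1 => /oppr_inj ->; rewrite -/(aj l); ring.
- have := crv2B S (bas (iu l)) (bas (iu l)) (bas (iu0 k)) (bas (iu l)).
  rewrite BS crv_s crv_u_zero_bas // w_l comp_bas !eqxx mul1r q_eq0.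
  rewrite !mulr1 => /oppr_inj ->; rewrite -/(aj l); ring.
Qed.

Lemma crv_0ll0 (p q h : 'I_k -> R) l :
  crv p q h (bas (iu0 k)) (bas (iu l)) (bas (iu l)) (bas (iu0 k)) = - q l * h l.
Proof.
rewrite /crv (@sum_only _ _ l) => [|j /negPf jl].
  by rewrite /formD /formE /wedge !comp_bas !indexE /=; ring.
by rewrite /formD /formE /wedge !comp_bas !indexE jl /=; ring.
Qed.

(** By [alB_multiple], p0, p1, p2 scale by a^2 b / r, a^3 b / r, a^4 b / r, so p0 p2 / p1^2 is
    invariant. The combination (q1 p0 - q0 p1) p1 / p0^4 is free of the shear [c] and scales by r^2,
    which the relation between the two signs absorbs. *)
Lemma isometry_invariants i : exists l,
  p0' l * p2' l * p1 i ^+ 2 = p0 i * p2 i * p1' l ^+ 2 /\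
  eps i.+1 * ((q1 i * p0 i - q0 i * p1 i) * p1 i) * p0' l ^+ 4 =
  eps l.+1 * ((q1' l * p0' l - q0' l * p1' l) * p1' l) * p0 i ^+ 4.
Proof.
have [l [a [r [a0 b0 alB epsO [E0 E1 E2]]]]] := alB_multiple i.
have r0 : r != 0.
  apply: contraTneq (eps_neq0 eps_sqr i) => r0.
  by rewrite -epsO r0 expr0n mulr0 eqxx.
exists l; split.
  apply: (mulIf (expf_neq0 2 r0)).
  have -> : p0' l * p2' l * p1 i ^+ 2 * r ^+ 2 =
    (p0' l * r) * (p2' l * r) * p1 i ^+ 2 by ring.
  have -> : p0 i * p2 i * p1' l ^+ 2 * r ^+ 2 = p0 i * p2 i * (p1' l * r) ^+ 2 by ring.
  by rewrite E0 E1 E2; ring.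
set b := be _ in b0 E0 E1 E2.
have al_e0 j : al j (B *m bas (iu0 k)) = 0.
  have [l' [a' [r' [_ _ -> _ _]]]] := alB_multiple j.
  by rewrite comp_bas indexE mulr0.
(* Distinct indices cannot be sent to the same [l]: evaluating on [A *m bas (iu i)] would make
   [al l] both zero and nonzero there. *)
have al_el j : j != i -> al j (B *m bas (iu l)) = 0.
  move=> ji; have [l' [a' [r' [a'0 _ alB' _ _]]]] := alB_multiple j.
  rewrite alB' comp_bas iu_eq; case: eqP => [ll'|_]; last by rewrite mulr0.
  have := alB' (A *m bas (iu i)); rewrite mulBA comp_bas iu_eq (negPf ji) ll'.
  move/esym/eqP; rewrite mulf_eq0 (negPf a'0) /= => /eqP lA0.
  have := alB (A *m bas (iu i)); rewrite mulBA comp_bas eqxx lA0 mulr0.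
  by move/eqP; rewrite oner_eq0.
have al_li : al i (B *m bas (iu l)) = a by rewrite alB comp_bas eqxx mulr1.
pose c := si i (B *m bas (iu0 k)).
have crvB (p q h : 'I_k -> R) :
    crv p q h (B *m bas (iu0 k)) (B *m bas (iu l)) (B *m bas (iu l))
      (B *m bas (iu0 k)) = - (q i * a ^+ 2 * b ^+ 2 + 2 * p i * a ^+ 2 * b * c) * h i.
  rewrite /crv (@sum_only _ _ i) => [|j ji].
    by rewrite /formD /formE /wedge al_e0 al_li -/b -/c; ring.
  by rewrite /formD /formE /wedge al_e0 al_el //; ring.
(* The unknown [c] is eliminated between [F0] and [F1]. *)
have F0 : q0' l = q0 i * a ^+ 2 * b ^+ 2 + 2 * p0 i * a ^+ 2 * b * c.
  have := crv0B (bas (iu0 k)) (bas (iu l)) (bas (iu l)) (bas (iu0 k)).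
  by rewrite crvB crv_0ll0 !mulr1 => /oppr_inj.
have F1 : q1' l = (q1 i * a ^+ 2 * b ^+ 2 + 2 * p1 i * a ^+ 2 * b * c) * a.
  have := crv1B (bas (iu0 k)) (bas (iu l)) (bas (iu l)) (bas (iu0 k)) (bas (iu l)).
  rewrite crvB crv_0ll0 al_li comp_bas eqxx mulr1 mulNr.
  by move/oppr_inj.
have J : (q1' l * p0' l - q0' l * p1' l) * r =
    (q1 i * p0 i - q0 i * p1 i) * a ^+ 5 * b ^+ 3.
  by rewrite mulrBl -!mulrA E0 E1 F0 F1; ring.
apply: (mulIf (expf_neq0 4 r0)).
rewrite -epsO.
have -> : eps l.+1 * r ^+ 2 * ((q1 i * p0 i - q0 i * p1 i) * p1 i) * p0' l ^+ 4 *
  r ^+ 4 = eps l.+1 * r ^+ 2 * ((q1 i * p0 i - q0 i * p1 i) * p1 i) *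
  (p0' l * r) ^+ 4 by ring.
have -> : eps l.+1 * ((q1' l * p0' l - q0' l * p1' l) * p1' l) * p0 i ^+ 4 * r ^+ 4 =
  eps l.+1 * r ^+ 2 * (((q1' l * p0' l - q0' l * p1' l) * r) * (p1' l * r)) * p0 i ^+ 4
  by ring.
by rewrite J E0 E1; ring.
Qed.

End IsometryAlgebra.

(** * Invariants of one variable *)

Lemma has_deriv_invf (R : realType) (V : normedModType R) (x v : V) (h : V -> R) a :
  has_deriv x v h a -> h x != 0 ->
  has_deriv x v (fun y => (h y)^-1) (- (a / h x ^+ 2)).
Proof.
move=> [dh ha] hx0; split; first exact: derivableV.
by rewrite deriveV // ha /GRing.scale /= mulNr mulrC.
Qed.

(** By the intermediate value theorem, a non-constant continuous function takes
    more than [size s] values. *)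
Lemma finite_range_constant (R : realType) (h : R -> R) (s : seq R) :
  (forall t, derivable h t 1) -> (forall t, h t \in s) -> forall t u, h t = h u.
Proof.
move=> dh hs t u; wlog tu : t u / t <= u.
  by move=> H; case: (leP t u) => [/H //|/ltW /H].
apply/eqP; apply: contraT => htu.
have s_gt0 : (0 < size s)%N by case: (s) (hs t).
have N0 : (size s)%:R != 0 :> R by rewrite pnatr_eq0 -lt0n.
(* For [j] from 0 to [size s] these are [size s + 1] distinct, equally spaced values between [h t]
   and [h u]. *)
pose v (j : nat) := h t + (h u - h t) * (j%:R / (size s)%:R).
have v_inj : injective v.
  move=> i j /addrI /(mulfI _) H; apply/eqP.
  rewrite -(@eqr_nat R); apply/eqP/(mulIf (invr_neq0 N0))/H.
  by rewrite subr_eq0 eq_sym.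
have v_in j : (j <= size s)%N -> v j \in s.
  move=> js; have [||c _ <-] := @IVT R h t u (v j) tu; last exact: hs.
    by apply: derivable_within_continuous.
  have r0 : 0 <= j%:R / (size s)%:R :> R by rewrite divr_ge0.
  have r1 : j%:R / (size s)%:R <= 1 :> R.
    by rewrite ler_pdivrMr ?mul1r ?ler_nat // ltr0n.
  rewrite /v; set r := _ / _ in r0 r1 *.
  rewrite ge_min le_max; case: (leP (h t) (h u)) => ht; apply/andP; split; apply/orP.
  - by left; nra.
  - by right; nra.
  - by right; nra.
  - by left; nra.
have : (size [seq v j | j <- iota 0 (size s).+1] <= size s)%N.
  apply: uniq_leq_size; first by rewrite map_inj_uniq ?iota_uniq.
  by move=> _ /mapP[j + ->]; rewrite mem_iota => /andP[_ ?]; exact: v_in.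
by rewrite size_map size_iota ltnn.
Qed.

Section Invariants.
Variables (R : realType) (h : R -> R).
Hypothesis h_smooth : smooth h.
Hypothesis w_neq0 : forall t, derive1n 1 h t + 1 != 0.
Hypothesis h2_neq0 : forall t, derive1n 2 h t != 0.

Let w (t : R) : R := derive1n 1 h t + 1.

(** In terms of the tensor coefficients, [inv2] is p0 p2 / p1^2 and [inv1] is minus eps (q1 p0 - q0
    p1) p1 / p0^4. The digit is the highest order of covariant derivative involved. *)
Definition inv2 t : R :=
  (derive1n 1 h t + 1) * derive1n 3 h t * (derive1n 2 h t ^+ 2)^-1.
Definition inv1 t : R :=
  (2 * h t * (2 * derive1n 1 h t + 1) * (derive1n 1 h t + 1)
   - h t ^+ 2 * derive1n 2 h t) * derive1n 2 h t * ((derive1n 1 h t + 1) ^+ 4)^-1.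

Let dh l t := has_deriv_derive1n l t h_smooth.

Ltac poly_deriv dw dh := repeat first [exact: dw | exact: dh
  | exact: has_deriv_cstf | apply: has_deriv_addf | apply: has_deriv_oppf
  | apply: has_deriv_mulf].
Ltac deriv_tac := repeat first [exact: (dh 0) | exact: dh
  | exact: has_deriv_cstf | apply: has_deriv_addf | apply: has_deriv_oppf
  | apply: has_deriv_mulf].

Lemma derivable_inv2 t : derivable inv2 t 1.
Proof.
suff [a []] : exists a, has_deriv t 1 inv2 a by [].
eexists; rewrite /inv2; apply: has_deriv_mulf; first by deriv_tac.
by apply: has_deriv_invf; [deriv_tac | rewrite expf_neq0].
Qed.

Lemma derivable_inv1 t : derivable inv1 t 1.
Proof.
suff [a []] : exists a, has_deriv t 1 inv1 a by [].
eexists; rewrite /inv1; apply: has_deriv_mulf; first by deriv_tac.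
by apply: has_deriv_invf; [deriv_tac | rewrite expf_neq0].
Qed.

Lemma has_deriv_zero (F : R -> R) (t a : R) : (forall t, F t = 0) ->
  has_deriv t 1 F a -> a = 0.
Proof.
move=> F0; have -> : F = fun=> 0 by exact/funext.
by move=> [_ <-]; exact: derive_cst.
Qed.

(** [inv2] constant means [(w / w')' = 1 - inv2], so [w / w'] is affine without
    zeros, hence constant. *)
Lemma inv2_constant c : (forall t, inv2 t = c) ->
  exists2 lam : R, lam != 0 & forall t, derive1n 2 h t = lam * w t.
Proof.
move=> inv2c.
have h3E t : w t * derive1n 3 h t = c * derive1n 2 h t ^+ 2.
  by rewrite -(inv2c t) /inv2 mulfVK // expf_neq0.
pose psi t := w t * (derive1n 2 h t)^-1 - (1 - c) * t.
have psi0 t u : psi t = psi u.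
  apply: is_derive_0_is_cst => {u}t; rewrite /psi /w; apply: has_deriv_eq.
    apply: has_deriv_addf.
      apply: has_deriv_mulf; first by deriv_tac.
      by apply: has_deriv_invf; [deriv_tac | exact: h2_neq0].
    apply: has_deriv_oppf; apply: has_deriv_mulf; first exact: has_deriv_cstf.
    exact: is_derive_id.
  rewrite mulrN mulrA -/(w t) h3E; have := h2_neq0 t.
  by move: (derive1n 2 h t) => z z0; field.
have wE t : w t = (psi 0 + (1 - c) * t) * derive1n 2 h t.
  by rewrite -(psi0 t 0) /psi subrK mulfVK.
have c1 : 1 - c = 0.
  apply/eqP; apply: contraT => c1.
  have := w_neq0 (- psi 0 / (1 - c)); rewrite -/(w _) wE mulrC.
  by rewrite [_ * (- _ / _)]mulrC divfK // addrN mulr0 eqxx.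
have w0 t : w t = psi 0 * derive1n 2 h t by rewrite wE c1 mul0r addr0.
have psi_neq0 : psi 0 != 0.
  by apply: contraNneq (w_neq0 0) => p0; rewrite -/(w _) w0 p0 mul0r.
by exists (psi 0)^-1; [rewrite invr_eq0 | move=> t; rewrite w0 mulKf].
Qed.

(** With w' = lam w and h' = w - 1, constancy of [inv1] becomes a polynomial relation in h and w.
    Repeated differentiation, dividing by lam and, when possible, by w, eliminates h and then w: 12
    - 4 c' = 0 remains, contradicting (12 - 4 c') w = 1. *)
Lemma inv1_inv2_not_constant c c' :
  (forall t, inv2 t = c) -> (forall t, inv1 t = c') -> False.
Proof.
move=> /inv2_constant[lam lam0 h2E] inv1c.
have dw (t : R) : has_deriv t 1 w (lam * w t).
  by rewrite -h2E -[derive1n 2 h t]addr0; rewrite /w; deriv_tac.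
have dh0 (t : R) : has_deriv t 1 h (w t - 1).
  by rewrite /w addrK; exact: (dh 0).
have E1 t : lam * (2 * h t * (2 * w t - 1) - lam * (h t * h t)) - c' * (w t * w t) = 0.
  have w0 : w t != 0 by exact: w_neq0.
  apply: (mulIf (mulf_neq0 w0 w0)); rewrite mul0r -(inv1c t) /inv1 h2E -/(w t).
  have -> : derive1n 1 h t = w t - 1 by rewrite /w addrK.
  by field.
have E2 t : (w t - 1) * (2 * w t - 1) + 2 * lam * h t * w t - lam * h t * (w t - 1)
    - c' * (w t * w t) = 0.
  apply: (mulfI (mulf_neq0 (x := 2) _ lam0)); first by rewrite pnatr_eq0.
  rewrite mulr0; apply: (has_deriv_zero (t := t) E1); apply: has_deriv_eq.
    by poly_deriv dw dh0.
  by rewrite /=; ring.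
have E3 t : 5 * (w t * w t) - 3 * w t - 1 + lam * h t * w t - 2 * c' * (w t * w t) = 0.
  apply: (mulfI lam0).
  rewrite mulr0; apply: (has_deriv_zero (t := t) E2); apply: has_deriv_eq.
    by poly_deriv dw dh0.
  by rewrite /=; ring.
have E4 t : 11 * w t - 4 + lam * h t - 4 * c' * w t = 0.
  apply: (mulfI (mulf_neq0 lam0 (w_neq0 t))).
  rewrite mulr0; apply: (has_deriv_zero (t := t) E3); apply: has_deriv_eq.
    by poly_deriv dw dh0.
  by rewrite /= -/(w t); ring.
have E5 t : 12 * w t - 1 - 4 * c' * w t = 0.
  apply: (mulfI lam0).
  rewrite mulr0; apply: (has_deriv_zero (t := t) E4); apply: has_deriv_eq.
    by poly_deriv dw dh0.
  by rewrite /=; ring.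
have E6 : 12 - 4 * c' = 0.
  apply: (mulfI (mulf_neq0 lam0 (w_neq0 0))).
  rewrite mulr0; apply: (has_deriv_zero (t := 0) E5); apply: has_deriv_eq.
    by poly_deriv dw dh0.
  by rewrite /= -/(w 0); ring.
have := E5 0; have -> : 12 * w 0 - 1 - 4 * c' * w 0 = (12 - 4 * c') * w 0 - 1 by ring.
by rewrite E6 mul0r sub0r => /eqP; rewrite oppr_eq0 oner_eq0.
Qed.

End Invariants.

(** * Comparison of the invariants at two points, and the conclusion *)

Lemma curv_homogeneous_invariants (R : realType) (k : nat) (f : nat -> R -> R)
    (eps : nat -> R) (P Q : 'rV[R]_(3 * k).+2) (i : 'I_k) :
  (forall i : 'I_k, eps i.+1 * eps i.+1 = 1) ->
  (forall i : 'I_k, smooth (f i.+1)) ->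
  (forall (i : 'I_k) t, derive1n 1 (f i.+1) t + 1 != 0) ->
  (forall (i : 'I_k) t, derive1n 2 (f i.+1) t != 0) ->
  curv_homogeneous (@gF R k f eps) 2 ->
  exists l : 'I_k,
    inv2 (f i.+1) (P ord0 (iu i)) = inv2 (f l.+1) (Q ord0 (iu l)) /\
    inv1 (f i.+1) (P ord0 (iu i)) = inv1 (f l.+1) (Q ord0 (iu l)).
Proof.
move=> eps_sqr f_smooth f1_neq0 f2_neq0 hom.
have [B [A [BA [mB c0 c1 c2]]]] :=
  curv_homogeneous_preserves eps_sqr f_smooth Q P hom.
have coefD0_neq0 x j : @coefD0 R k f x j != 0 by rewrite oppr_eq0.
have [l [E2 E1]] := isometry_invariants eps_sqr BA (coefD0_neq0 P) (coefD0_neq0 Q)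
  mB c0 c1 c2 i.
exists l; move: E2 E1; rewrite /coefD0 /coefD1 /coefD2 /coefE0 /coefE1 /curv_q1 /inv1 /inv2.
have := f1_neq0 i (P ord0 (iu i)); have := f1_neq0 l (Q ord0 (iu l)).
have := f2_neq0 i (P ord0 (iu i)); have := f2_neq0 l (Q ord0 (iu l)).
have := eps_sqr i; have := eps_sqr l.
(* Only field identities remain: [a0] to [a3] will stand for the derivatives of [f i.+1] at [P], and
   [b0] to [b3] for those of [f l.+1] at [Q]. *)
move: (f i.+1 _) (derive1n 1 (f i.+1) _) (derive1n 2 (f i.+1) _).
move: (derive1n 3 (f i.+1) _) (f l.+1 _) (derive1n 1 (f l.+1) _).
move: (derive1n 2 (f l.+1) _) (derive1n 3 (f l.+1) _) (eps i.+1) (eps l.+1).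
move=> b2 b3 e e' a3 b0 b1 a0 a1 a2 e'e' ee b2n a2n b1n a1n E2 E1.
split.
  apply: (mulIf (mulf_neq0 (expf_neq0 2 a2n) (expf_neq0 2 b2n))).
  transitivity ((a1 + 1) * a3 * b2 ^+ 2); first by field.
  transitivity ((b1 + 1) * b3 * a2 ^+ 2); last by field.
  by move: E2; rewrite !mulrNN !sqrrN => ->.
apply: (mulIf (mulf_neq0 (expf_neq0 4 a1n) (expf_neq0 4 b1n))).
transitivity ((2 * a0 * (2 * a1 + 1) * (a1 + 1) - a0 ^+ 2 * a2) * a2 * (b1 + 1) ^+ 4).
  by field.
transitivity ((2 * b0 * (2 * b1 + 1) * (b1 + 1) - b0 ^+ 2 * b2) * b2 * (a1 + 1) ^+ 4);
  last by field.
(* The squares of the signs are inserted since q0 and q1 each carry a factor [eps]. *)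
apply: oppr_inj; rewrite -[LHS]mul1r -[RHS]mul1r -[X in X * _ = _]ee
  -[X in _ = X * _]e'e'.
transitivity (e * ((- (2 * e * a0 * (2 * a1 + 1)) * - (a1 + 1) -
    - (e * a0 ^+ 2) * - a2) * - a2) * (- (b1 + 1)) ^+ 4); first by ring.
by rewrite E1; ring.
Qed.

Theorem theorem1p9 (R : realType) (k : nat) (f : nat -> R -> R) (eps : nat -> R) :
  (1 <= k)%N ->
  (forall i : nat, (1 <= i <= k)%N -> eps i = 1 \/ eps i = -1) ->
  (forall i : nat, (1 <= i <= k)%N -> smooth (f i)) ->
  (forall i : nat, (1 <= i <= k)%N -> forall u : R, derive1 (f i) u + 1 != 0) ->
  (forall i : nat, (1 <= i <= k)%N -> forall u : R, derive1n 2 (f i) u != 0) ->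
  ~ curv_homogeneous (@gF R k f eps) 2.
Proof.
move=> k_gt0 eps_pm1 f_smooth f1_neq0 f2_neq0 hom.
have ik (i : 'I_k) : (1 <= i.+1 <= k)%N by exact: ltn_ord.
have eps_sqr (i : 'I_k) : eps i.+1 * eps i.+1 = 1.
  by case: (eps_pm1 _ (ik i)) => ->; rewrite ?mulrNN mulr1.
have f_smooth' (i : 'I_k) := f_smooth _ (ik i).
have f1_neq0' (i : 'I_k) := f1_neq0 _ (ik i).
have f2_neq0' (i : 'I_k) := f2_neq0 _ (ik i).
pose i0 : 'I_k := Ordinal k_gt0.
(* The point with all coordinates [t] is compared with the origin, so the right-hand sides depend on
   [l] alone and take at most [k] values. *)
have invs t : exists l : 'I_k,
    inv2 (f 1%N) t = inv2 (f l.+1) 0 /\ inv1 (f 1%N) t = inv1 (f l.+1) 0.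
  have [l] := curv_homogeneous_invariants (const_mx t) 0 i0 eps_sqr f_smooth'
    f1_neq0' f2_neq0' hom.
  by rewrite !mxE; exists l.
have const2 : forall t, inv2 (f 1%N) t = inv2 (f 1%N) 0.
  move=> t; refine (@finite_range_constant _ (inv2 (f 1%N))
    [seq inv2 (f l.+1) 0 | l : 'I_k <- enum 'I_k] _ _ t 0).
    by move=> u; apply: (derivable_inv2 (f_smooth' i0)); exact: (f2_neq0' i0).
  by move=> u; have [l [-> _]] := invs u;
    apply: (map_f (fun l : 'I_k => inv2 (f l.+1) 0)); rewrite mem_enum.
have const1 : forall t, inv1 (f 1%N) t = inv1 (f 1%N) 0.
  move=> t; refine (@finite_range_constant _ (inv1 (f 1%N))
    [seq inv1 (f l.+1) 0 | l : 'I_k <- enum 'I_k] _ _ t 0).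
    by move=> u; apply: (derivable_inv1 (f_smooth' i0)); exact: (f1_neq0' i0).
  by move=> u; have [l [_ ->]] := invs u;
    apply: (map_f (fun l : 'I_k => inv1 (f l.+1) 0)); rewrite mem_enum.
exact: (inv1_inv2_not_constant (f_smooth' i0) (f1_neq0' i0) (f2_neq0' i0) const2 const1).
Qed.
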